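(* Let $G$ be a commutative connected algebraic group over a number field $K$ and let $A\subseteq G(K)$ be a finitely generated and torsion-free subgroup of rank $r>0$. For every prime $\ell$, let $H_\ell(G)$ denote the image of $H(G)$ under the projection $\mathrm{GL}_s(\hat{\mathbb{Z}})\to\mathrm{GL}_s(\mathbb{Z}_\ell)$ and denote by $\mathbb{Z}_\ell[H_\ell(G)]$ the closed sub-$\mathbb{Z}_\ell$-algebra of $\mathrm{Mat}_{s\times s}(\mathbb{Z}_\ell)$ generated by $H_\ell(G)$. Assume that (1) the group $A$ admits a divisibility parameter $d_A$ in $G(K)$; (2) there is an integer $n\geq 1$ such that $\mathbb{Z}_\ell[H_\ell(G)]\supseteq \ell^{v_\ell(n)}\mathrm{Mat}_{s\times s}(\mathbb{Z}_\ell)$ for every prime $\ell$; (3) there is an integer $m\geq 1$ such that the exponent of $H^1(\mathrm{Gal}(K_\infty\mid K),G_{\mathrm{tors}})$ divides $m$. Then $V(A)$ is open in $\mathrm{Mat}_{s\times r}(\hat{\mathbb{Z}})$. More precisely, the order of $\mathrm{Ent}(A)$ divides $(d_Anm)^{rs}$.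
   Context: Fix an algebraic closure $\overline{K}$. Let $s\geq 0$ be the integer with $G(\overline{K})[n]\cong(\mathbb{Z}/n\mathbb{Z})^s$ for all $n\geq 1$. Write $G_{\mathrm{tors}}=G(\overline{K})_{\mathrm{tors}}$, $K_\infty=K(G_{\mathrm{tors}})$, and $\Gamma=\{P\in G(\overline{K})\mid \exists\, k\geq 1: kP\in A\}$; $K(\Gamma)$ is the field generated over $K$ by the points of $\Gamma$. A divisibility parameter for $A$ in $G(K)$ is a positive integer $d_A$ with $d_A(\Gamma\cap G(K))\subseteq A+G(K)_{\mathrm{tors}}$. Fix an isomorphism $\Phi:\Gamma\to\mathbb{Q}^r\oplus(\mathbb{Q}/\mathbb{Z})^s$ mapping $A$ onto $\mathbb{Z}^r$; it identifies $\mathrm{Aut}(G_{\mathrm{tors}})$ with $\mathrm{Aut}((\mathbb{Q}/\mathbb{Z})^s)=\mathrm{GL}_s(\hat{\mathbb{Z}})$ and $\mathrm{Hom}(\Gamma/(A+G_{\mathrm{tors}}),G_{\mathrm{tors}})$ with $\mathrm{Hom}((\mathbb{Q}/\mathbb{Z})^r,(\mathbb{Q}/\mathbb{Z})^s)=\mathrm{Mat}_{s\times r}(\hat{\mathbb{Z}})$ (homomorphisms of $(\mathbb{Q}/\mathbb{Z})^k$ correspond to $\hat{\mathbb{Z}}$-matrices in the natural way). $H(G)\subseteq\mathrm{GL}_s(\hat{\mathbb{Z}})$ is the image of $\mathrm{Gal}(K_\infty\mid K)$ acting on $G_{\mathrm{tors}}$. The Kummer map sends $\sigma\in\mathrm{Gal}(K(\Gamma)\mid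 K_\infty)$ to the homomorphism $[b]\mapsto\sigma(b)-b$ from $\Gamma/(A+G_{\mathrm{tors}})$ to $G_{\mathrm{tors}}$; $V(A)\subseteq\mathrm{Mat}_{s\times r}(\hat{\mathbb{Z}})$ is its image, and the entanglement group $\mathrm{Ent}(A)$ is the cokernel $\mathrm{Hom}(\Gamma/(A+G_{\mathrm{tors}}),G_{\mathrm{tors}})/V(A)$. $H^1$ denotes Galois cohomology with $G_{\mathrm{tors}}$ discrete. $\mathrm{Mat}_{s\times r}(\hat{\mathbb{Z}})$ carries the profinite topology. *)

(* Defs.v *)
From HB Require Import structures.
From mathcomp Require Import all_boot all_order all_algebra ring_quotient.
From mathcomp Require Import boolp classical_sets functions cardinality.
From mathcomp Require Import topology_structure product_topology.
From mathcomp Require Import initial_topology nat_topology matrix_topology function_spaces.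
From mathcomp.multinomials Require Import mpoly.

Set Implicit Arguments.
Unset Strict Implicit.
Unset Printing Implicit Defensive.

Import Order.TTheory GRing.Theory Num.Theory.
Local Open Scope classical_set_scope.
Local Open Scope ring_scope.

(* [K] is the base field and [iota : K -> L] an algebraic closure.  In
   characteristic 0 every algebraic group over [K] is reduced, and over any
   field every algebraic group is quasi-projective, so an algebraic group over
   [K] is determined by a locally closed subset of some P^N(L) cut out by
   homogeneous polynomials over [K], with a group law given locally by
   polynomials over [K]. *)

Section Varieties.
Variables (K L : fieldType) (iota : {rmorphism K -> L}).

Definition homogeneous n (F : {mpoly K[n]}) := exists d, F \is d.-homog.

(* The locus where all of [qp_eqs] vanish and some of [qp_neqs] does not. *)
Record qproj := QProj {
  qp_dim : nat;
  qp_eqs : seq {mpoly K[qp_dim.+1]};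
  qp_neqs : seq {mpoly K[qp_dim.+1]};
  qp_eqs_homog : {in qp_eqs, forall F, homogeneous F};
  qp_neqs_homog : {in qp_neqs, forall F, homogeneous F} }.

Definition pval n (F : {mpoly K[n]}) (v : 'rV[L]_n) : L := mmap iota (v 0) F.

(* A point of projective space is represented by its unique homogeneous
   coordinate vector whose first nonzero entry is 1; these entries generate
   the field of definition of the point. *)
Definition normalized n (v : 'rV[L]_n) : bool :=
  [exists i, (v 0 i == 1) && [forall j : 'I_n, (j < i)%N ==> (v 0 j == 0)]].

Definition on_qproj (X : qproj) (v : 'rV[L]_(qp_dim X).+1) : bool :=
  [&& normalized v, all (fun F => pval F v == 0) (qp_eqs X)
    & has (fun F => pval F v != 0) (qp_neqs X)].

(* X(L) *)
Record point (X : qproj) := Point {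
  coords : 'rV[L]_(qp_dim X).+1; _ : on_qproj coords }.

HB.instance Definition _ X := [isSub for @coords X].
HB.instance Definition _ X := [Choice of point X by <:].

Definition bihomogeneous n (a b : nat) (F : {mpoly K[n + n]}) :=
  {in msupp F, forall m : 'X_{1..n + n},
    (\sum_(i < n) m (lshift n i))%N = a /\ (\sum_(i < n) m (rshift n i))%N = b}.

(* Morphisms X -> X and X x X -> X over K: around every point the map is given
   by (bi)homogeneous polynomials over K of the same (bi)degree. *)
Definition regular1 (X : qproj) (f : point X -> point X) :=
  forall P, exists d (F : 'I_(qp_dim X).+1 -> {mpoly K[(qp_dim X).+1]}),
    let ev (P' : point X) := \row_i pval (F i) (coords P') in
    [/\ forall i, F i \is d.-homog, ev P != 0
      & forall P', ev P' != 0 -> exists c : L, ev P' = c *: coords (f P')].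

Definition regular2 (X : qproj) (f : point X -> point X -> point X) :=
  forall P Q, exists a b
    (F : 'I_(qp_dim X).+1 -> {mpoly K[(qp_dim X).+1 + (qp_dim X).+1]}),
    let ev (P' Q' : point X) :=
      \row_i pval (F i) (row_mx (coords P') (coords Q')) in
    [/\ forall i, bihomogeneous a b (F i), ev P Q != 0
      & forall P' Q', ev P' Q' != 0 ->
          exists c : L, ev P' Q' = c *: coords (f P' Q')].

(* iota(K) as a subset of L *)
Definition base_field : {pred L} := [pred x | `[< exists a, x = iota a >]].

Definition point_over X (F : {pred L}) : {pred point X} :=
  [pred P | [forall i, coords P 0 i \in F]].

Record cAlgGroup := CAlgGroup {
  cag_var : qproj;
  cag_add : point cag_var -> point cag_var -> point cag_var;
  cag_opp : point cag_var -> point cag_var;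
  cag_zero : point cag_var;
  cag_addA : associative cag_add;
  cag_addC : commutative cag_add;
  cag_add0 : left_id cag_zero cag_add;
  cag_addN : left_inverse cag_zero cag_opp cag_add;
  cag_add_regular : regular2 cag_add;
  cag_opp_regular : regular1 cag_opp;
  cag_zero_rational : cag_zero \in point_over base_field }.

Definition gpt (G : cAlgGroup) := point (cag_var G).

HB.instance Definition _ G := Choice.on (gpt G).
HB.instance Definition _ (G : cAlgGroup) := GRing.isZmodule.Build (gpt G)
  (@cag_addA G) (@cag_addC G) (@cag_add0 G) (@cag_addN G).

Definition zero_locus (X : qproj) (S : seq {mpoly K[(qp_dim X).+1]}) :
  set (point X) := [set P | {in S, forall F, pval F (coords P) = 0}].

(* Connectedness for the Zariski topology of the K-variety. *)
Definition zariski_connected (X : qproj) :=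
  forall S T : seq {mpoly K[(qp_dim X).+1]},
    {in S, forall F, homogeneous F} -> {in T, forall F, homogeneous F} ->
    zero_locus S `|` zero_locus T = [set: point X] ->
    zero_locus S `&` zero_locus T = set0 ->
    zero_locus S = set0 \/ zero_locus T = set0.

(* K(S) *)
Definition field_of_points X (S : set (point X)) : {pred L} :=
  [pred x | `[< forall F : {pred L}, divring_closed F ->
     {subset base_field <= F} -> S `<=` [set P | P \in point_over F] ->
     x \in F >]].

(* Gal(F | E) for subfields E, F of L.  An automorphism of F is represented by
   a function on L which is the identity off F, so that distinct functions
   represent distinct automorphisms. *)
Record is_gal (E F : {pred L}) (sigma : L -> L) : Prop := IsGal {
  gal_stable : {in F, forall x, sigma x \in F};
  gal_surj : {in F, forall y, exists2 x, x \in F & sigma x = y};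
  gal1 : sigma 1 = 1;
  galD : {in F &, {morph sigma : x y / x + y}};
  galM : {in F &, {morph sigma : x y / x * y}};
  gal_fix : {in E, sigma =1 id};
  gal_off : forall x, x \notin F -> sigma x = x }.

(* The default value is never used when P has coordinates in F and
   sigma is in Gal(F | E) with E containing K: see [gal_actE] below. *)
Definition gal_act (G : cAlgGroup) (sigma : L -> L) (P : gpt G) : gpt G :=
  insubd (P : point (cag_var G)) (map_mx sigma (coords P)).

End Varieties.

Section GaloisAction.
Variables (K L : fieldType) (iota : {rmorphism K -> L}).
Variables (F : {pred L}) (divF : divring_closed F).
Hypothesis KF : {subset base_field iota <= F}.

Let F1 : 1 \in F. Proof. by case: divF. Qed.
Let FB x y : x \in F -> y \in F -> x - y \in F.
Proof. by case: divF => _ + _; apply. Qed.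
Let FV x y : x \in F -> y \in F -> x / y \in F.
Proof. by case: divF => _ _; apply. Qed.
Let F0 : 0 \in F. Proof. by rewrite -(subrr 1) FB. Qed.
Let FD x y : x \in F -> y \in F -> x + y \in F.
Proof. by move=> xF yF; rewrite -[y]opprK FB // -sub0r FB. Qed.
Let FM x y : x \in F -> y \in F -> x * y \in F.
Proof. by move=> xF yF; rewrite -[y]invrK FV // -div1r FV. Qed.
Let FX x n : x \in F -> x ^+ n \in F.
Proof. by move=> xF; elim: n => [|n IH]; rewrite ?expr0 // exprS FM. Qed.

Lemma normalized_scale n (c : L) (u v : 'rV[L]_n) :
  normalized u -> normalized v -> u = c *: v -> u = v.
Proof.
move=> /existsP[i /andP[/eqP ui /forallP u0]].
move=> /existsP[j /andP[/eqP vj /forallP v0]] uv.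
have uE k : u 0 k = c * v 0 k by rewrite uv mxE.
suff -> : u = 1 *: v by rewrite scale1r.
rewrite {1}uv; congr (_ *: _).
have c0 : c != 0.
  by apply/eqP => c0; move: (uE i) (oner_neq0 L); rewrite ui c0 mul0r => ->; rewrite eqxx.
case: (ltngtP i j) => ij.
- have := implyP (v0 i) ij => /eqP vi.
  by move: (uE i) (oner_neq0 L); rewrite ui vi mulr0 => ->; rewrite eqxx.
- have := implyP (u0 j) ij => /eqP uj.
  by move: (uE j); rewrite uj vj mulr1 => c0'; rewrite -c0' eqxx in c0.
- by move/val_inj: ij => ij; move: (uE i); rewrite ui ij vj mulr1.
Qed.

Lemma pval_over n (p : {mpoly K[n]}) (v : 'rV[L]_n) :
  (forall i, v 0 i \in F) -> pval iota p v \in F.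
Proof.
move=> vF; rewrite /pval /mmap; elim/big_ind: _ => // m _.
apply: FM; first by apply: KF; apply/asboolP; exists p@_m.
by rewrite /mmap1; elim/big_ind: _ => // i _; apply: FX.
Qed.

Variable sigma : L -> L.
Variable E : {pred L}.
Hypothesis KE : {subset base_field iota <= E}.
Hypothesis galS : is_gal E F sigma.

Let s0 : sigma 0 = 0.
Proof.
by apply: (addrI (sigma 0)); rewrite -(galD galS) // !addr0.
Qed.

Let sX x n : x \in F -> sigma (x ^+ n) = sigma x ^+ n.
Proof.
move=> xF; elim: n => [|n IH]; first by rewrite !expr0 (gal1 galS).
by rewrite !exprS (galM galS) ?FX // IH.
Qed.

Let s_eq0 x : x \in F -> sigma x = 0 -> x = 0.
Proof.
move=> xF sx0; apply/eqP/negP => /negP x0.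
have : sigma (x * x^-1) = 0.
  by rewrite (galM galS) ?sx0 ?mul0r // -div1r FV.
by rewrite divff // (gal1 galS) => /eqP; rewrite oner_eq0.
Qed.

Lemma gal_pval n (p : {mpoly K[n]}) (v : 'rV[L]_n) :
  (forall i, v 0 i \in F) -> pval iota p (map_mx sigma v) = sigma (pval iota p v).
Proof.
move=> vF; rewrite /pval /mmap.
pose R x y := (y \in F) /\ x = sigma y.
suff [] : R (\sum_(m <- msupp p) iota p@_m * mmap1 ((map_mx sigma v) 0) m)
            (\sum_(m <- msupp p) iota p@_m * mmap1 (v 0) m) by [].
elim/big_rec2: _ => [|m y x _ [xF ->]]; first by split.
have KFm : iota p@_m \in base_field iota by apply/asboolP; exists p@_m.
have [mF mE] : R (mmap1 ((map_mx sigma v) 0) m) (mmap1 (v 0) m).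
  rewrite /mmap1; elim/big_rec2: _ => [|i y' x' _ [x'F ->]].
    by split; rewrite ?(gal1 galS).
  by split; rewrite ?FM ?FX // (galM galS) ?FX // mxE sX.
have pF := KF KFm; have pE : sigma (iota p@_m) = iota p@_m.
  by apply: (gal_fix galS); apply: KE.
split; first by rewrite FD ?FM.
by rewrite (galD galS) ?FM // (galM galS) // mE pE.
Qed.

Variable G : cAlgGroup iota.
Implicit Types P Q : gpt G.

Lemma gal_actE P : P \in point_over F ->
  coords (gal_act sigma P) = map_mx sigma (coords P).
Proof.
move=> /forallP PF; apply: insubdK; have /and3P[nP eP hP] := valP P.
apply/and3P; split.
- have /existsP[i /andP[/eqP Pi /forallP Pj]] := nP.
  apply/existsP; exists i; rewrite mxE Pi (gal1 galS) eqxx /=.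
  by apply/forallP => j; apply/implyP => /(implyP (Pj j))/eqP; rewrite mxE => ->; rewrite s0.
- apply/allP => p pX; rewrite gal_pval //.
  by have /eqP -> := allP eP _ pX; rewrite s0.
- have /hasP[p pX /eqP p0] := hP; apply/hasP; exists p => //.
  by rewrite gal_pval //; apply/eqP => /(s_eq0 (pval_over _ PF)).
Qed.

Lemma point_overD P Q : P \in point_over F -> Q \in point_over F ->
  P + Q \in point_over F.
Proof.
move=> /forallP PF /forallP QF.
have [a [b [f /= [_ ev0 evP]]]] := @cag_add_regular _ _ _ G P Q.
have [c cE] := evP _ _ ev0.
set w := \row_i _ in ev0 cE.
have wF i : w 0 i \in F.
  rewrite mxE pval_over // => j; case: (split_ordP j) => k ->.
    by rewrite row_mxEl.
  by rewrite row_mxEr.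
have /and3P[/existsP[i /andP[/eqP Pi _]] _ _] := valP (P + Q).
have cF : c \in F.
  by have := wF i; rewrite cE mxE [X in _ * X]Pi mulr1.
have c0 : c != 0 by apply: contra_neq ev0 => c0; rewrite cE c0 scale0r.
apply/forallP => j; have := wF j; rewrite cE mxE => /FV /(_ cF).
by rewrite mulrC mulKf.
Qed.

Lemma gal_actD P Q : P \in point_over F -> Q \in point_over F ->
  gal_act sigma (P + Q) = gal_act sigma P + gal_act sigma Q.
Proof.
move=> PF QF; have PQF := point_overD PF QF.
have [a [b [f /= [_ ev0 evP]]]] := @cag_add_regular _ _ _ G P Q.
have [c cE] := evP _ _ ev0.
have PQr i : row_mx (coords P) (coords Q) 0 i \in F.
  case: (split_ordP i) => k ->.
    by rewrite row_mxEl; apply: (forallP PF).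
  by rewrite row_mxEr; apply: (forallP QF).
have evS : \row_i pval iota (f i) (row_mx (coords (gal_act sigma P))
    (coords (gal_act sigma Q))) =
    map_mx sigma (\row_i pval iota (f i) (row_mx (coords P) (coords Q))).
  apply/rowP => i; rewrite !mxE !gal_actE // -map_row_mx gal_pval //.
set w := \row_i _ in ev0 cE evS.
have wF i : w 0 i \in F by rewrite mxE pval_over.
have /existsP[i0 /andP[/eqP e1 _]] : normalized (coords (cag_add P Q)).
  by have /and3P[] := valP (cag_add P Q).
have cF : c \in F by have := wF i0; rewrite cE mxE e1 mulr1.
have c0 : c != 0 by apply: contra_neq ev0 => c0; rewrite cE c0 scale0r.
have [|c' c'E] := evP (gal_act sigma P) (gal_act sigma Q).
  rewrite evS; apply/eqP => /rowP w0; move/eqP: ev0; apply.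
  by apply/rowP => i; rewrite [RHS]mxE; apply: s_eq0 => //; have := w0 i; rewrite !mxE.
apply/val_inj; rewrite /= gal_actE //.
apply: (@normalized_scale _ ((sigma c)^-1 * c')).
- rewrite -gal_actE //; by have /and3P[] := valP (gal_act sigma (P + Q)).
- by have /and3P[] := valP (gal_act sigma P + gal_act sigma Q).
have sc0 : sigma c != 0 by apply/eqP => /(s_eq0 cF)/eqP; rewrite (negPf c0).
rewrite -scalerA -c'E evS cE; apply/rowP => i; rewrite !mxE.
by rewrite (galM galS) ?mulKf //; apply: (forallP PQF).
Qed.

End GaloisAction.

Section Gamma.
Variables (K L : fieldType) (iota : {rmorphism K -> L}) (G : cAlgGroup iota).

(* G_tors *)
Definition torsion : {pred gpt G} :=
  [pred P | `[< exists2 k : nat, (0 < k)%N & P *+ k = 0 >]].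

Lemma torsion_closed : zmod_closed torsion.
Proof.
split=> [|P Q]; first by apply/asboolP; exists 1%N.
move=> /asboolP[k k0 Pk] /asboolP[l l0 Ql].
apply/asboolP; exists (k * l)%N; first by rewrite muln_gt0 k0.
by rewrite mulrnBl mulrnA Pk mul0rn mulnC mulrnA Ql mul0rn subrr.
Qed.
HB.instance Definition _ := GRing.isZmodClosed.Build (gpt G) torsion
  torsion_closed.

Record tors := Tors { tors_val :> gpt G; _ : tors_val \in torsion }.
HB.instance Definition _ := [isSub for tors_val].
HB.instance Definition _ := [Choice of tors by <:].
HB.instance Definition _ := [SubChoice_isSubZmodule of tors by <:].

Variable A : zmodClosed (gpt G).

(* Gamma *)
Definition div_hull : {pred gpt G} :=
  [pred P | `[< exists2 k : nat, (0 < k)%N & P *+ k \in A >]].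

Lemma div_hull_closed : zmod_closed div_hull.
Proof.
split=> [|P Q]; first by apply/asboolP; exists 1%N; rewrite // mulr1n rpred0.
move=> /asboolP[k k0 Pk] /asboolP[l l0 Ql].
apply/asboolP; exists (k * l)%N; first by rewrite muln_gt0 k0.
rewrite mulrnBl rpredB //; first by rewrite mulrnA rpredMn.
by rewrite mulnC mulrnA rpredMn.
Qed.
HB.instance Definition _ := GRing.isZmodClosed.Build (gpt G) div_hull
  div_hull_closed.

Record gam := Gam { gam_val :> gpt G; gam_valP : gam_val \in div_hull }.
HB.instance Definition _ := [isSub for gam_val].
HB.instance Definition _ := [Choice of gam by <:].
HB.instance Definition _ := [SubChoice_isSubZmodule of gam by <:].

Lemma tors_div_hull (t : tors) : tors_val t \in div_hull.
Proof.
case: t => t /= /asboolP[k k0 tk].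
by apply/asboolP; exists k; rewrite // tk rpred0.
Qed.
Definition gam_of_tors (t : tors) : gam := Gam (tors_div_hull t).

(* A + G_tors, as a subgroup of Gamma *)
Definition A_tors : {pred gam} :=
  [pred b | `[< exists2 a, a \in A & gam_val b - a \in torsion >]].

Lemma A_tors_closed : zmod_closed A_tors.
Proof.
split=> [|b c]; first by apply/asboolP; exists 0; rewrite ?subrr rpred0.
move=> /asboolP[x xA bx] /asboolP[y yA cy].
apply/asboolP; exists (x - y); first by rewrite rpredB.
have -> : gam_val (b - c) = gam_val b - gam_val c by [].
by rewrite opprD addrACA -opprD rpredB.
Qed.
HB.instance Definition _ := GRing.isZmodClosed.Build gam A_tors A_tors_closed.

(* Gamma / (A + G_tors) *)
Definition gam_quot := Quotient.quot A_tors.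
Definition gam_class (b : gam) : gam_quot := (\pi_gam_quot b)%qT.

Definition divisibility_parameter (d : nat) :=
  (0 < d)%N /\
  forall P, P \in div_hull -> P \in point_over (base_field iota) ->
    exists a t, [/\ a \in A, t \in torsion, t \in point_over (base_field iota)
      & P *+ d = a + t].

End Gamma.

Arguments torsion {K L iota} G.

Definition ratz : {pred rat} := [pred x | x \is a Num.int].
Lemma ratz_closed : zmod_closed ratz.
Proof. by split=> [|x y]; rewrite !inE ?rpred0 //; apply: rpredB. Qed.
HB.instance Definition _ := GRing.isZmodClosed.Build rat ratz ratz_closed.

Definition QZ := Quotient.quot ratz.
Definition qz (x : rat) : QZ := (\pi_QZ x)%qT.

(* The limit of the rings Z/n over the n > 0 all of whose prime factors lie in
   [pi], an element being the compatible family of its residues in [0, n[.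
   For [pi := predT] this is the ring of profinite integers; for [pi := ell]
   a prime, it is the ring of ell-adic integers. *)
Section PiAdic.
Variable pi : nat_pred.

Definition compatible (f : nat -> nat) : bool :=
  `[< (forall n, ~~ pi.-nat n -> f n = 0%N) /\
      (forall m n, pi.-nat m -> n %| m -> f m %% n = f n)%N >].

Record zpi := Zpi { residue : nat -> nat; _ : compatible residue }.

HB.instance Definition _ := [isSub for residue].
HB.instance Definition _ := [Choice of zpi by <:].

(* Profinite topology: induced by the product of the discrete spaces Z/n. *)
HB.instance Definition _ := Topological.copy zpi
  (initial_topology (residue : zpi -> {ptws nat -> nat})).

Lemma residue_off x n : ~~ pi.-nat n -> residue x n = 0%N.
Proof. by case: x => f /= /asboolP[+ _]; apply. Qed.

Lemma residue_mod x m n : pi.-nat m -> (n %| m)%N ->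
  (residue x m %% n)%N = residue x n.
Proof. by case: x => f /= /asboolP[_ +]; apply. Qed.

Lemma residue_modn x n : (residue x n %% n)%N = residue x n.
Proof.
have [pin|npin] := boolP (pi.-nat n); first exact: residue_mod.
by rewrite residue_off ?mod0n.
Qed.

Lemma zpi_eq x y :
  (forall n, pi.-nat n -> residue x n = residue y n) -> x = y.
Proof.
move=> xy; apply/val_inj/funext => n /=.
by have [/xy//|npin] := boolP (pi.-nat n); rewrite !residue_off.
Qed.

Definition trunc (f : nat -> nat) n : nat :=
  if pi.-nat n then (f n %% n)%N else 0%N.

Lemma trunc_compatible (f : nat -> nat) :
  (forall m n, pi.-nat m -> n %| m -> f m = f n %[mod n])%N ->
  compatible (trunc f).
Proof.
move=> fP; apply/asboolP; split=> [n /negPf|m n pim nm]; rewrite /trunc.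
  by move=> ->.
by rewrite pim (pnat_dvd nm pim) modn_dvdm // fP.
Qed.

Lemma residue_eqmod x m n : pi.-nat m -> (n %| m)%N ->
  residue x m = residue x n %[mod n].
Proof. by move=> pim nm; rewrite residue_modn residue_mod. Qed.

Fact const_subproof k m n : pi.-nat m -> (n %| m)%N -> k = k %[mod n].
Proof. by []. Qed.
Fact add_subproof x y m n : pi.-nat m -> (n %| m)%N ->
  (residue x m + residue y m = residue x n + residue y n %[mod n])%N.
Proof.
move=> pim nm; rewrite -modnDm (residue_eqmod x pim nm).
by rewrite (residue_eqmod y pim nm) modnDm.
Qed.
Fact mul_subproof x y m n : pi.-nat m -> (n %| m)%N ->
  (residue x m * residue y m = residue x n * residue y n %[mod n])%N.
Proof.
move=> pim nm; rewrite -modnMm (residue_eqmod x pim nm).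
by rewrite (residue_eqmod y pim nm) modnMm.
Qed.
Fact residue_le x n : (0 < n)%N -> (residue x n <= n)%N.
Proof. by move=> n0; rewrite -residue_modn ltnW // ltn_mod. Qed.
Fact opp_subproof x m n : pi.-nat m -> (n %| m)%N ->
  (m - residue x m = n - residue x n %[mod n])%N.
Proof.
move=> pim nm; have pin := pnat_dvd nm pim.
have [m0 n0] : (0 < m)%N /\ (0 < n)%N by case/andP: pim; case/andP: pin.
apply/eqP; rewrite -(eqn_modDr (residue x m)) subnK ?residue_le //.
rewrite -modnDmr (residue_eqmod x pim nm) modnDmr subnK ?residue_le //.
by rewrite modnn; apply/eqP; apply/eqP; exact: nm.
Qed.

Definition zpi_zero := Zpi (trunc_compatible (@const_subproof 0)).
Definition zpi_one := Zpi (trunc_compatible (@const_subproof 1)).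
Definition zpi_opp x := Zpi (trunc_compatible (opp_subproof x)).
Definition zpi_add x y := Zpi (trunc_compatible (add_subproof x y)).
Definition zpi_mul x y := Zpi (trunc_compatible (mul_subproof x y)).

Fact zpi_addA : associative zpi_add.
Proof.
move=> x y z; apply: zpi_eq => n pin /=; rewrite /trunc pin.
by rewrite modnDmr modnDml addnA.
Qed.
Fact zpi_addC : commutative zpi_add.
Proof. by move=> x y; apply: zpi_eq => n pin /=; rewrite /trunc addnC. Qed.
Fact zpi_add0 : left_id zpi_zero zpi_add.
Proof.
move=> x; apply: zpi_eq => n pin /=; rewrite /trunc pin.
by rewrite mod0n add0n residue_modn.
Qed.
Fact zpi_addN : left_inverse zpi_zero zpi_opp zpi_add.
Proof.
move=> x; apply: zpi_eq => n pin /=; rewrite /trunc pin modnDml subnK.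
  by rewrite modnn mod0n.
by apply: residue_le; case/andP: pin.
Qed.
HB.instance Definition _ :=
  GRing.isZmodule.Build zpi zpi_addA zpi_addC zpi_add0 zpi_addN.

Fact zpi_mulA : associative zpi_mul.
Proof.
move=> x y z; apply: zpi_eq => n pin /=; rewrite /trunc pin.
by rewrite modnMmr modnMml mulnA.
Qed.
Fact zpi_mulC : commutative zpi_mul.
Proof. by move=> x y; apply: zpi_eq => n pin /=; rewrite /trunc mulnC. Qed.
Fact zpi_mul1 : left_id zpi_one zpi_mul.
Proof.
move=> x; apply: zpi_eq => n pin /=; rewrite /trunc pin.
by rewrite modnMml mul1n residue_modn.
Qed.
Fact zpi_mulDl : left_distributive zpi_mul zpi_add.
Proof.
move=> x y z; apply: zpi_eq => n pin /=; rewrite /trunc pin.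
by rewrite modnMml modnDm mulnDl.
Qed.
HB.instance Definition _ := GRing.Zmodule_isComPzRing.Build zpi
  zpi_mulA zpi_mulC zpi_mul1 zpi_mulDl.

End PiAdic.

Definition Zhat := zpi predT.

Fact zproj_subproof (pi : nat_pred) (x : Zhat) m n :
  pi.-nat m -> (n %| m)%N -> residue x m = residue x n %[mod n].
Proof. by case/andP=> m0 _; apply: residue_eqmod; rewrite /pnat m0; apply/allP. Qed.

Definition zproj (pi : nat_pred) (x : Zhat) : zpi pi :=
  Zpi (trunc_compatible (@zproj_subproof pi x)).

(* x . [a/b] = [(x mod b) a/b] *)
Definition zhat_act (x : Zhat) (q : QZ) : QZ :=
  qz ((residue x `|denq (repr q)|%N)%:R * repr q).

Definition zhat_mxact s r (M : 'M[Zhat]_(s, r)) (q : 'cV[QZ]_r) : 'cV[QZ]_s :=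
  \col_i \sum_j zhat_act (M i j) (q j 0).

(* The closed sub-Z_ell-algebra of Mat_s(Z_ell) generated by a set. *)
Definition closed_alg_gen (ell : nat) s (H : set 'M[zpi ell]_s) :
  set 'M[zpi ell]_s :=
  [set M | forall S : set 'M[zpi ell]_s,
     closed S -> H `<=` S -> S 1%:M ->
     (forall B C, S B -> S C -> S (B + C)) ->
     (forall B C, S B -> S C -> S (B *m C)) ->
     (forall a B, S B -> S (a *: B)) -> S M].

Section Rank.
Variables (V : zmodType) (A : {pred V}).

Definition finitely_generated :=
  exists n (v : 'I_n -> V), (forall i, v i \in A) /\
    {in A, forall P, exists c : 'I_n -> int, P = \sum_i v i *~ c i}.

Definition torsion_free :=
  {in A, forall P k, (0 < k)%N -> P *+ k = 0 -> P = 0}.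

Definition independent n (v : 'I_n -> V) :=
  forall c : 'I_n -> int, \sum_i v i *~ c i = 0 -> forall i, c i = 0.

Definition has_rank (r : nat) :=
  (exists v : 'I_r -> V, (forall i, v i \in A) /\ independent v) /\
  (forall v : 'I_r.+1 -> V, (forall i, v i \in A) -> ~ independent v).

End Rank.

Section Kummer.
Variables (K L : fieldType) (iota : {rmorphism K -> L}) (G : cAlgGroup iota).

(* ['I_n.+1] is the additive group Z/(n+1), including the trivial group for
   n = 0, so this is G[n] ~ (Z/n)^s for all n > 0. *)
Definition torsion_rank (s : nat) :=
  forall n, exists f : {additive 'cV['I_n.+1]_s -> gpt G},
    injective f /\ range f = [set P | P *+ n.+1 = 0].

Definition K_infty : {pred L} :=
  field_of_points [set P : gpt G | P \in torsion G].

(* Gal(K_infty | K) *)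
Definition Gal_infty : set (L -> L) := is_gal (base_field iota) K_infty.

Definition tors_act (sigma : L -> L) (t : tors G) : tors G :=
  insubd t (gal_act sigma t).

Lemma field_of_points_closed (X : qproj K) (S : set (point iota X)) :
  divring_closed (field_of_points S).
Proof.
split=> [|x y /asboolP xS /asboolP yS|x y /asboolP xS /asboolP yS];
  apply/asboolP => F dF KF SF; case: (dF) => F1 FB FV //.
- by apply: FB; [apply: xS|apply: yS].
- by apply: FV; [apply: xS|apply: yS].
Qed.

Lemma base_field_of_points (X : qproj K) (S : set (point iota X)) :
  {subset base_field iota <= field_of_points S}.
Proof. by move=> x xK; apply/asboolP => F _ KF _; apply: KF. Qed.

Lemma points_over_field (X : qproj K) (S : set (point iota X)) P :
  S P -> P \in point_over (field_of_points S).
Proof.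
move=> SP; apply/forallP => i; apply/asboolP => F _ _ SF.
by have /forallP := SF _ SP; apply.
Qed.

(* The default value in [tors_act] is not used. *)
Lemma tors_actE sigma (t : tors G) : Gal_infty sigma ->
  tors_val (tors_act sigma t) = gal_act sigma t.
Proof.
move=> galS; apply: insubdK; case: t => t tT /=.
have dF := field_of_points_closed [set P : gpt G | P \in torsion G].
have KF := @base_field_of_points _ [set P : gpt G | P \in torsion G].
have actD := gal_actD dF KF (fun x => id) galS (G := G).
have tF (u : gpt G) : u \in torsion G -> u \in point_over K_infty.
  exact: points_over_field.
have act0 : gal_act sigma (0 : gpt G) = 0.
  by apply: (addrI (gal_act sigma 0)); rewrite -actD ?addr0 ?tF ?rpred0.
have actM k : gal_act sigma (t *+ k) = gal_act sigma t *+ k.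
  elim: k => [|k IH]; first by rewrite !mulr0n.
  by rewrite !mulrS actD ?IH ?tF // rpredMn.
have /asboolP[k k0 tk] := tT; apply/asboolP; exists k => //.
by rewrite -actM tk act0.
Qed.

Definition cocycle (c : (L -> L) -> tors G) :=
  {in Gal_infty &, forall sigma tau,
    c (sigma \o tau) = c sigma + tors_act sigma (c tau)}.

(* Continuity for the Krull topology and the discrete topology on G_tors. *)
Definition krull_continuous (c : (L -> L) -> tors G) :=
  {in Gal_infty, forall sigma, exists S : seq L, {subset S <= K_infty} /\
    {in Gal_infty, forall tau, {in S, tau =1 sigma} -> c tau = c sigma}}.

Definition coboundary (c : (L -> L) -> tors G) :=
  exists t, {in Gal_infty, forall sigma, c sigma = tors_act sigma t - t}.

Definition kills_H1 (k : nat) :=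
  forall c, cocycle c -> krull_continuous c ->
    coboundary (fun sigma => c sigma *+ k).

(* e is the exponent of H^1(Gal(K_infty | K), G_tors) *)
Definition exponent_H1 (e : nat) :=
  [/\ (0 < e)%N, kills_H1 e
    & forall k, (0 < k)%N -> kills_H1 k -> (e <= k)%N].

Variable A : zmodClosed (gpt G).

(* K(Gamma) *)
Definition K_Gamma : {pred L} :=
  field_of_points [set P : gpt G | P \in div_hull A].

Definition kummer_hom := {additive gam_quot A -> tors G}.

(* The image of the Kummer map in Hom(Gamma / (A + G_tors), G_tors). *)
Definition kummer_image : set kummer_hom :=
  [set h : kummer_hom | exists2 sigma, is_gal K_infty K_Gamma sigma &
     forall b : gam A, tors_val (h (gam_class b)) = gal_act sigma b - gam_val b].

(* Ent(A), as the set of cosets of the image of the Kummer map *)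
Definition Ent : set (set kummer_hom) :=
  [set [set h' : kummer_hom |
         exists2 v : kummer_hom, kummer_image v & forall x, h' x = h x + v x]
  | h in [set: kummer_hom]].

Variables (r s : nat) (Phi : gam A -> 'cV[rat]_r * 'cV[QZ]_s).

Definition maps_onto_Zr :=
  Phi @` [set b | gam_val b \in A] =
  range (fun z : 'cV[int]_r => (map_mx intr z, 0)).

(* M is the matrix of h under the identification of
   Hom(Gamma / (A + G_tors), G_tors) with Mat_{s x r}(Zhat) given by Phi. *)
Definition matrix_of_hom (M : 'M[Zhat]_(s, r)) (h : kummer_hom) :=
  forall b : gam A, (Phi (gam_of_tors A (h (gam_class b)))).2 =
    zhat_mxact M (map_mx qz (Phi b).1).

(* V(A) *)
Definition kummer_matrices : set 'M[Zhat]_(s, r) :=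
  [set M | exists2 h : kummer_hom, kummer_image h & matrix_of_hom M h].

(* H(G) *)
Definition torsion_matrices : set 'M[Zhat]_s :=
  [set M | (exists N, M *m N = 1%:M /\ N *m M = 1%:M) /\
     exists2 sigma, Gal_infty sigma & forall t : tors G,
       (Phi (gam_of_tors A (tors_act sigma t))).2 =
       zhat_mxact M (Phi (gam_of_tors A t)).2].

(* H_ell(G) *)
Definition torsion_matrices_at (ell : nat) : set 'M[zpi ell]_s :=
  [set map_mx (zproj ell) M | M in torsion_matrices].

End Kummer.

Arguments Ent {K L iota G} A.
Arguments torsion_matrices_at {K L iota G A r s} Phi ell _.

(* Main.v *)
(* Write [X] for [Gamma / (A + G_tors)], [T] for [G_tors], and [V] for the image
   of the Kummer map in [Hom (X, T)].  [V] is a closed subgroup, stable under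
   composition with the automorphisms of [T] induced by [Gal(K_infty | K)], hence
   under the algebra they generate; by (2) and the Chinese remainder theorem
   this algebra contains [n E_ij] modulo every [q], where [E_ij] is a matrix unit.
   An [x] in [X] killed by all of [V] is represented by a point [b] over [K_infty],
   and [sigma |-> sigma b - b] is a cocycle with values in [T]: by (3) some
   [m b - t], with [t] torsion, is rational, so that [d_A m x = 0] by (1).
   Therefore, by duality between (Z/q)^r and [X[q]], the rows of the matrices of
   the elements of [V] modulo [q] generate a group containing [d_A m (Z/q)^r], and
   multiplying by the [n E_ij] puts [d_A m n Hom (X, T)] inside [V].  The quotient
   of [Hom (X, T)] by [d_A m n Hom (X, T)] embeds into Mat_{s x r}(Z / d_A m n). *)
Require Import Defs.
From HB Require Import structures.
From mathcomp Require Import all_fingroup.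
From mathcomp Require Import all_boot all_order all_algebra all_field.
From mathcomp Require Import ring_quotient.
From mathcomp Require Import boolp classical_sets functions cardinality.
From mathcomp Require Import topology_structure matrix_topology.
From mathcomp Require Import product_topology initial_topology nat_topology.
From mathcomp Require Import function_spaces discrete_topology.
Import Order.TTheory GRing.Theory Num.Theory.
Local Open Scope classical_set_scope.
Local Open Scope ring_scope.
Local Open Scope card_scope.

Set Implicit Arguments.
Unset Strict Implicit.
Unset Printing Implicit Defensive.

(** * Extending automorphisms to an algebraic closure *)

(** Galois elements are handled as automorphisms of all of [L], which can be composed, inverted and
    conjugated freely. Extending them to [L] uses partial embeddings encoded by their graphs,
    subrings of [L * L]: a polynomial over such a ring carries both a polynomial over the source and
    its image, and since [L] is algebraic over [K] no closure under inversion has to be required.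
    The inclusion of N Hom (X, T) in [V], with N = d_A m n, is used in an equivalent form, X being
    divisible: every homomorphism that kills X[N] lies in [V]. It is proved on one X[q] at a time,
    where homomorphisms are integer matrices modulo q, and the levels are joined by the closedness
    of [V]. Since q is arbitrary while (2) speaks of one prime at a time, the matrix units have to
    be glued from prime powers. The same form gives openness: two homomorphisms whose matrices agree
    modulo N differ by one that kills X[N]. The exponent rs is the number of entries of a matrix. *)

Definition diag (T : nzRingType) (z : T) : T * T := (z, z).

Fact diag_zmod_morphism (T : nzRingType) : zmod_morphism (@diag T).
Proof. by []. Qed.
HB.instance Definition _ (T : nzRingType) :=
  GRing.isZmodMorphism.Build T (T * T)%type (@diag T) (@diag_zmod_morphism T).
Fact diag_monoid_morphism (T : nzRingType) : monoid_morphism (@diag T).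
Proof. by []. Qed.
HB.instance Definition _ (T : nzRingType) :=
  GRing.isMonoidMorphism.Build T (T * T)%type (@diag T) (@diag_monoid_morphism T).

Lemma map_fst_diag (T : nzRingType) (p : {poly T}) :
  map_poly fst (map_poly (@diag T) p) = p.
Proof. by apply/polyP => i; rewrite !coef_map. Qed.

Section Embeddings.
Variables (K : fieldType) (L : closedFieldType) (iota : {rmorphism K -> L}).
Hypothesis L_algebraic : integralRange iota.

(** Cancelling powers of [X] in an integral equation of [x] leaves a non-zero constant term, and the
    equation can be solved for the inverse. *)
Lemma integral_inverse (x : L) : x != 0 ->
  exists q : {poly K}, (map_poly iota q).[x] * x = 1.
Proof.
move=> x0; have [p /monic_neq0 + /rootP] := L_algebraic x.
elim/poly_ind: p => [|p c IH]; first by rewrite eqxx.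
rewrite rmorphD rmorphM /= map_polyX map_polyC /= !hornerE.
have [->|c0] := eqVneq c 0.
  rewrite !rmorph0 !addr0 => pX0 /eqP; rewrite mulf_eq0 (negPf x0) orbF => /eqP.
  by apply: IH; apply: contraNneq pX0 => ->; rewrite mul0r.
move=> _ /eqP; rewrite addr_eq0 => /eqP pxE.
exists (- c^-1 *: p); rewrite map_polyZ hornerZ -mulrA pxE rmorphN fmorphV.
by rewrite mulNr mulrN opprK mulVf ?fmorph_eq0.
Qed.

(* The graph of a field embedding over [K], from a subfield of [L] to [L]. *)
Record embedding_graph (R : set (L * L)) : Prop := EmbeddingGraph {
  graph_base : forall a, R (iota a, iota a);
  graph_sub : forall z w, R z -> R w -> R (z - w);
  graph_mul : forall z w, R z -> R w -> R (z * w);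
  graph_fun : forall y, R (0, y) -> y = 0 }.

Section Graph.
Variables (R : set (L * L)) (grR : embedding_graph R).

Lemma graph0 : R 0.
Proof. by have := graph_base grR 0; rewrite rmorph0. Qed.
Lemma graph1 : R 1.
Proof. by have := graph_base grR 1; rewrite rmorph1. Qed.
Lemma graph_opp z : R z -> R (- z).
Proof. by move=> Rz; rewrite -sub0r; apply: graph_sub => //; apply: graph0. Qed.
Lemma graph_add z w : R z -> R w -> R (z + w).
Proof. by move=> Rz Rw; rewrite -[w]opprK; apply: graph_sub => //; apply: graph_opp. Qed.

(** The inverse of [a] is a polynomial in [a] over [K]; the same polynomial in [b] inverts [b],
    because [graph_fun] carries the relation from the first coordinate to the second. *)
Lemma graph_inv (a b : L) : R (a, b) -> a != 0 -> R (a^-1, b^-1).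
Proof.
move=> Rab a0; have [q qa] := integral_inverse a0.
have Rq : R ((map_poly iota q).[a], (map_poly iota q).[b]).
  elim/poly_ind: (q) => [|p c IH]; first by rewrite !rmorph0 !horner0; apply: graph0.
  rewrite !rmorphD !rmorphM /= !map_polyX !map_polyC /= !hornerE.
  exact: graph_add (graph_mul grR IH Rab) (graph_base grR c).
have qb : (map_poly iota q).[b] * b = 1.
  apply/eqP; rewrite -subr_eq0; apply/eqP; apply: (graph_fun grR).
  have := graph_sub grR (graph_mul grR Rq Rab) graph1.
  by congr (R (_, _)); rewrite /= qa subrr.
have b0 : b != 0.
  by apply: contraTneq (oner_neq0 L) => b0; rewrite -qb b0 mulr0 eqxx.
by rewrite -[a^-1]mul1r -qa mulfK // -[b^-1]mul1r -qb mulfK.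
Qed.

(** Coefficients are pairs in the graph: [map_poly fst p] is the minimal polynomial of [x] over the
    source, and [map_poly snd p] is its image under the embedding. *)
Record minimal_poly (x : L) (p : {poly L * L}) : Prop := MinimalPoly {
  minp_monic : p \is monic;
  minp_coef : forall i, R p`_i;
  minp_root : (map_poly fst p).[x] = 0;
  minp_min : forall q, q \is monic -> (forall i, R q`_i) ->
    (map_poly fst q).[x] = 0 -> (size p <= size q)%N }.

Lemma minimal_poly_exists x : exists p, minimal_poly x p.
Proof.
pose P k := `[< exists2 p : {poly L * L}, p \is monic & [/\ forall i, R p`_i,
  (map_poly fst p).[x] = 0 & size p = k] >].
have exP : exists k, P k.
  have [p mp /rootP px] := L_algebraic x.
  pose pp := map_poly (@diag L) (map_poly iota p).
  exists (size pp); apply/asboolP; exists pp; last split=> //.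
  - by rewrite !monic_map.
  - by move=> i; rewrite !coef_map; apply: graph_base.
  by rewrite map_fst_diag.
case: (ex_minnP exP) => k /asboolP[p mp [Rp px sp]] kmin.
exists p; split=> // q mq Rq qx; rewrite sp; apply: kmin.
by apply/asboolP; exists q.
Qed.

Section Adjoin.
Variables (x y : L) (p : {poly L * L}).
Hypothesis minp : minimal_poly x p.
Hypothesis py : (map_poly snd p).[y] = 0.

(** Euclidean division by [p] inside the graph: [L * L] has zero divisors, but every non-zero
    element of [R] is invertible in [R]. A polynomial shorter than [p] could be made monic, against
    [minp_min]; a longer one loses its leading term. *)
Lemma minimal_poly_transfer (q : {poly L * L}) : (forall i, R q`_i) ->
  (map_poly fst q).[x] = 0 -> (map_poly snd q).[y] = 0.
Proof.
have [k] := ubnP (size q); elim: k q => // k IH q /ltnSE sqk Rq qx.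
have [->|q0] := eqVneq q 0; first by rewrite rmorph0 horner0.
set c := lead_coef q.
have [c0 Rc] : c != 0 /\ R c by rewrite lead_coef_eq0; split=> //; apply: Rq.
have c10 : c.1 != 0.
  apply: contraNneq c0; case: (c) Rc => a b /= Rab a0.
  by rewrite a0 in Rab *; rewrite (graph_fun grR Rab).
have [cV RcV cVc] : exists2 d, R d & d * c = 1.
  exists (c.1^-1, c.2^-1); first by apply: graph_inv => //; case: (c) Rc.
  have RV : R (c.1^-1, c.2^-1) by apply: graph_inv => //; case: (c) Rc.
  apply/eqP; rewrite -subr_eq0; apply/eqP.
  have e1 : ((c.1^-1, c.2^-1) * c - 1).1 = 0 by rewrite /= mulVf ?subrr.
  have := graph_sub grR (graph_mul grR RV Rc) graph1; move: e1.
  case: (_ - 1) => u v /= -> /(graph_fun grR) -> //.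
have [sqp|spq] := ltnP (size q) (size p).
  have := minp_min minp (q := cV *: q); rewrite leqNgt => /(_ _ _ _)/negP[].
  - rewrite monicE lead_coefE.
    (* Scaling may lower the size in a ring with zero divisors; here the top coefficient becomes
       1. *)
    have s1 : size (cV *: q) = size q.
      apply/eqP; rewrite eqn_leq size_scale_leq /=.
      have sq0 : (0 < size q)%N by rewrite size_poly_gt0.
      rewrite -(prednK sq0) ltnNge; apply/negP => /leq_sizeP /(_ _ (leqnn _)).
      by rewrite coefZ -lead_coefE cVc => /eqP; rewrite oner_eq0.
    by rewrite s1 coefZ -lead_coefE cVc.
  - by move=> i; rewrite coefZ; apply: graph_mul.
  - rewrite map_polyZ hornerZ qx mulr0 //.
  - exact: leq_ltn_trans (size_scale_leq _ _) sqp.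
pose j := (size q - size p)%N; pose q' := q - c *: ('X^j * p).
have sp0 : (0 < size p)%N by rewrite size_poly_gt0 monic_neq0 ?(minp_monic minp).
have sXp : size ('X^j * p) = size q.
  rewrite size_Mmonic ?(minp_monic minp) ?monic_neq0 ?monicXn // size_polyXn.
  by rewrite addSn subnK.
have lXp : lead_coef ('X^j * p) = 1.
  by rewrite lead_coef_Mmonic ?(minp_monic minp) // lead_coefXn.
have Rq' i : R q'`_i.
  rewrite coefB coefZ coefXnM; apply: graph_sub => //; apply: graph_mul => //.
  by case: ifP => _; [apply: graph0|apply: (minp_coef minp)].
have q'E (f : {rmorphism L * L -> L}) (z : L) : (map_poly f p).[z] = 0 ->
    (map_poly f q').[z] = (map_poly f q).[z].
  move=> pz; rewrite rmorphB /= map_polyZ rmorphM /= hornerD hornerN hornerZ.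
  by rewrite hornerM pz !mulr0 subr0.
rewrite -(q'E snd) //; apply: IH => //; last by rewrite (q'E fst) ?(minp_root minp).
apply: leq_trans sqk.
have sq0 : (0 < size q)%N by rewrite size_poly_gt0.
rewrite -(prednK sq0) ltnS; apply/leq_sizeP => i.
rewrite leq_eqVlt coefB coefZ => /predU1P[<-|qi].
  by rewrite -{2}sXp -!lead_coefE lXp mulr1 subrr.
rewrite (prednK sq0) in qi.
by rewrite !nth_default ?mulr0 ?subrr ?sXp.
Qed.

(** Evaluating at [(x, y)] the polynomials over the graph yields the graph of the extension sending
    [x] to [y]; [minimal_poly_transfer] makes it single-valued. *)
Lemma adjoin_graph :
  embedding_graph [set q.[(x, y)] | q in [set q : {poly L * L} | forall i, R q`_i]].
Proof.
split=> [a|_ _ [q Rq <-] [q' Rq' <-]|_ _ [q Rq <-] [q' Rq' <-]|z [q Rq]].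
- exists (iota a, iota a)%:P; last by rewrite hornerC.
  by move=> i; rewrite coefC; case: ifP => _; [apply: graph_base|apply: graph0].
- exists (q - q'); last by rewrite hornerD hornerN.
  by move=> i; rewrite coefB; apply: graph_sub.
- exists (q * q'); last by rewrite hornerM.
  move=> i; rewrite coefM; elim/big_ind: _ => [||k _].
  + exact: graph0.
  + exact: graph_add.
  exact: graph_mul.
move=> qz; have /(congr1 fst) /= q1 := qz; have /(congr1 snd) /= <- := qz.
have := horner_map snd q (x, y) => /= <-; apply: minimal_poly_transfer => //.
by have := horner_map fst q (x, y) => /= ->.
Qed.

Lemma adjoin_graph_sub :
  R `<=` [set q.[(x, y)] | q in [set q : {poly L * L} | forall i, R q`_i]].
Proof.
move=> z Rz; exists z%:P; last by rewrite hornerC.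
by move=> i; rewrite coefC; case: ifP => _ //; apply: graph0.
Qed.

Lemma adjoin_graph_mem :
  [set q.[(x, y)] | q in [set q : {poly L * L} | forall i, R q`_i]] (x, y).
Proof.
exists 'X; last by rewrite hornerX.
move=> i; rewrite coefX; case: eqP => _; [exact: graph1|exact: graph0].
Qed.

End Adjoin.
End Graph.

Lemma embedding_graph_bigcup (F : set (set (L * L))) :
  F !=set0 -> F `<=` embedding_graph -> total_on F subset ->
  embedding_graph (\bigcup_(R in F) R).
Proof.
move=> [R0 FR0] FG Ftot.
split=> [a|z w [R1 F1 z1] [R2 F2 w2]|z w [R1 F1 z1] [R2 F2 w2]|y [R1 F1 y1]].
- by exists R0 => //; apply: graph_base; apply: FG.
- have [R12|R21] := Ftot _ _ F1 F2.
    by exists R2 => //; apply: (graph_sub (FG _ F2)) => //; apply: R12.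
  by exists R1 => //; apply: (graph_sub (FG _ F1)) => //; apply: R21.
- have [R12|R21] := Ftot _ _ F1 F2.
    by exists R2 => //; apply: (graph_mul (FG _ F2)) => //; apply: R12.
  by exists R1 => //; apply: (graph_mul (FG _ F1)) => //; apply: R21.
exact: (graph_fun (FG _ F1)).
Qed.

(* An injective self-map of the finite set of roots of a polynomial over [K]
   is onto. *)
Lemma algebraic_endo_surj (F : {pred L}) (sigma : L -> L) :
  divring_closed F -> {subset base_field iota <= F} ->
  {in F, forall x, sigma x \in F} -> {in base_field iota, sigma =1 id} ->
  {in F &, {morph sigma : x y / x + y}} -> {in F &, {morph sigma : x y / x * y}} ->
  {in F, forall y, exists2 x, x \in F & sigma x = y}.
Proof.
move=> [F1 FB FV] KF sF sK sD sM y yF.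
have KP a : iota a \in base_field iota by apply/asboolP; exists a.
have F0 : 0 \in F by rewrite -(subrr 1) FB.
have FN z : z \in F -> - z \in F by move=> zF; rewrite -sub0r FB.
have FD z w : z \in F -> w \in F -> z + w \in F.
  by move=> zF wF; rewrite -[w]opprK FB ?FN.
have FM z w : z \in F -> w \in F -> z * w \in F.
  by move=> zF wF; rewrite -[w]invrK FV // -div1r FV.
have s0 : sigma 0 = 0 by rewrite -(rmorph0 iota) sK ?KP.
have s1 : sigma 1 = 1 by rewrite -(rmorph1 iota) sK ?KP.
have sinj : {in F &, injective sigma}.
  move=> z w zF wF szw; apply/eqP; rewrite -subr_eq0; apply/negP => /negP d0.
  have dF : z - w \in F by rewrite FB.
  have sd0 : sigma (z - w) = 0.
    apply: (addIr (sigma w)); rewrite -sD // subrK add0r //.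
  have dVF : (z - w)^-1 \in F by rewrite -div1r FV.
  have := sM _ _ dF dVF; rewrite divff // s1 sd0 mul0r => /eqP.
  by rewrite oner_eq0.
have [p mp /rootP py] := L_algebraic y.
have [rs prs] := closed_field_poly_normal (map_poly iota p).
have rsE z : (z \in rs) = root (map_poly iota p) z.
  by rewrite prs rootZ ?root_prod_XsubC // lead_coef_eq0 map_poly_eq0 monic_neq0.
have pF z q : z \in F -> (map_poly iota q).[z] \in F /\
    sigma (map_poly iota q).[z] = (map_poly iota q).[sigma z].
  move=> zF; elim/poly_ind: q => [|q c [IHF IH]].
    by rewrite rmorph0 !horner0.
  rewrite rmorphD rmorphM /= map_polyX map_polyC /= !hornerE.
  split; first by rewrite FD ?FM ?(KF _ (KP c)).
  have cF : iota c \in F by rewrite KF ?KP.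
  by rewrite sD ?FM // sM // IH (sK _ (KP c)).
pose t := [seq z <- undup rs | z \in F].
have tE z : (z \in t) = (z \in F) && root (map_poly iota p) z.
  by rewrite mem_filter mem_undup rsE.
have ut : uniq t by rewrite filter_uniq ?undup_uniq.
have ust : uniq (map sigma t).
  rewrite map_inj_in_uniq // => z w; rewrite !tE => /andP[zF _] /andP[wF _].
  exact: sinj.
have sst : {subset map sigma t <= t}.
  move=> _ /mapP[z + ->]; rewrite !tE => /andP[zF /rootP pz]; rewrite sF //=.
  by apply/rootP; have [_ <-] := pF z p zF; rewrite pz s0.
have [_ /(_ y)] := uniq_min_size ust sst (eq_leq (esym (size_map _ _))).
rewrite [RHS]tE yF; have -> : root (map_poly iota p) y by apply/rootP.
by case/mapP => z; rewrite tE => /andP[zF _] ->; exists z.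
Qed.

Lemma predT_divring : divring_closed (predT : {pred L}).
Proof. by split. Qed.

(** A maximal graph is total, since any [x] can be adjoined along with a root in [L] of the image of
    its minimal polynomial. *)
Theorem embedding_graph_extend (R : set (L * L)) : embedding_graph R ->
  exists2 sigma, is_gal (base_field iota) predT sigma &
    forall a b, R (a, b) -> sigma a = b.
Proof.
(* Taking the union with [R] makes the condition true for the empty chain, and keeps [R] inside the
   maximal graph. *)
move=> grR; pose P X := embedding_graph (X `|` R).
have [|Y [PY Ymax]] := @Zorn_bigcup (L * L)%type P.
  move=> F FP Ftot; have [->|/set0P F0] := eqVneq F set0.
    by rewrite /P bigcup_set0 set0U.
  have FR : [set X `|` R | X in F] !=set0.
    by have [X FX] := F0; exists (X `|` R), X.
  rewrite /P; suff -> : \bigcup_(X in F) X `|` R =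
      \bigcup_(Z in [set X `|` R | X in F]) Z.
    apply: embedding_graph_bigcup => // [_ [X FX <-]|_ _ [X FX <-] [Z FZ <-]].
      exact: FP.
    by have [XZ|ZX] := Ftot _ _ FX FZ; [left|right]; apply: setSU.
  rewrite bigcup_image /=; apply/seteqP; split=> [z [[X FX Xz]|Rz]|z [X FX [Xz|Rz]]].
  - by exists X => //; left.
  - by have [X FX] := F0; exists X => //; right.
  - by left; exists X.
  - by right.
set Z := Y `|` R in PY.
have total x : exists y, Z (x, y).
  have [p minp] := minimal_poly_exists PY x.
  have [|y /rootP py] := closed_rootP (map_poly snd p) _.
    rewrite size_map_poly_id0; last by rewrite (monicP (minp_monic minp)) oner_neq0.
    apply/negP => /eqP/(congr1 (fun k => (k <= 1)%N)); rewrite leqnn => /eqP sp.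
    move/eqP: sp => sp; have := size1_polyC sp => pE.
    have := monicP (minp_monic minp); rewrite pE lead_coefC => c1.
    have := minp_root minp; rewrite pE c1 rmorph1 hornerC => /eqP.
    by rewrite oner_eq0.
  exists y; apply: contrapT => nZ.
  have YW : Y `<` [set q.[(x, y)] | q in [set q : {poly L * L} | forall i, Z q`_i]].
    rewrite properEneq; split.
      apply/negP => /eqP YE; apply: nZ; left; rewrite YE.
      exact: adjoin_graph_mem.
    by apply: subset_trans (adjoin_graph_sub PY x y); apply: subsetUl.
  apply: (Ymax _ YW); rewrite /P setUidl; first exact: adjoin_graph minp py.
  by apply: subset_trans (adjoin_graph_sub PY x y); apply: subsetUr.
have Zfun x y y' : Z (x, y) -> Z (x, y') -> y = y'.
  move=> xy xy'; apply/eqP; rewrite -subr_eq0; apply/eqP/(graph_fun PY).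
  by have := graph_sub PY xy xy'; congr Z; congr (_, _); rewrite /= subrr.
have [sigma sP] := choice total.
have sE x y : Z (x, y) -> sigma x = y by move=> xy; apply: Zfun xy.
have sK : {in base_field iota, sigma =1 id}.
  by move=> _ /asboolP[a ->]; apply: sE; apply: graph_base.
have sD : {in predT &, {morph sigma : x y / x + y}}.
  by move=> x y _ _; apply: sE; exact: (graph_add PY (sP x) (sP y)).
have sM : {in predT &, {morph sigma : x y / x * y}}.
  by move=> x y _ _; apply: sE; exact: (graph_mul PY (sP x) (sP y)).
exists sigma; last by move=> a b Rab; apply: sE; right.
split=> //; first exact: algebraic_endo_surj predT_divring _ _ sK sD sM.
by rewrite -(rmorph1 iota) sK //; apply/asboolP; exists 1.
Qed.


(** * Extension of Galois automorphisms to [L], and elements that they move *)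

Section Galois.
Variables E F : {pred L}.
Hypotheses (divE : divring_closed E) (divF : divring_closed F).
Hypotheses (KE : {subset base_field iota <= E}) (EF : {subset E <= F}).

Lemma gal_extend sigma : is_gal E F sigma ->
  exists2 tau, is_gal E predT tau & {in F, tau =1 sigma}.
Proof.
move=> galS; have [F1 FB FV] := divF.
have FM z w : z \in F -> w \in F -> z * w \in F.
  by move=> zF wF; rewrite -[w]invrK FV // -div1r FV.
have F0 : 0 \in F by rewrite -(subrr 1) FB.
have sB : {in F &, {morph sigma : x y / x - y}}.
  move=> x y xF yF; apply: (addIr (sigma y)).
  by rewrite -(galD galS) ?FB // !subrK.
have [|tau galT tauE] := @embedding_graph_extend
    [set z : L * L | z.1 \in F /\ z.2 = sigma z.1].
  split=> [a|[a b] [c d] /= [aF ->] [cF ->]|[a b] [c d] /= [aF ->] [cF ->]|y /= [_ ->]].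
  - have aE : iota a \in E by apply: KE; apply/asboolP; exists a.
    by split; rewrite ?(gal_fix galS) //; apply: EF.
  - by split; rewrite ?FB ?sB.
  - by split; rewrite ?FM // (Defs.galM galS).
  - by have := sB 1 1 F1 F1; rewrite !subrr.
exists tau => [|x xF]; last exact: tauE.
case: galT => *; split=> // x xE.
have := tauE x (sigma x) (conj (EF xE) erefl).
by rewrite (gal_fix galS).
Qed.

Hypothesis char0 : forall k, (0 < k)%N -> k%:R != 0 :> L.

(* In characteristic 0 the minimal polynomial of [x] over [E] is not a power of
   ['X - x], for otherwise its derivative would have a smaller degree. *)
Lemma gal_moves x : x \notin E ->
  exists2 tau, is_gal E predT tau & tau x != x.
Proof.
move=> xE; have [E1 EB EV] := divE.
have EM z w : z \in E -> w \in E -> z * w \in E.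
  by move=> zF wF; rewrite -[w]invrK EV // -div1r EV.
pose R := [set z : L * L | z.1 \in E /\ z.2 = z.1].
have grR : embedding_graph R.
  rewrite /R; split=> [a|[a b] [c d] /= [aE ->] [cE ->]|[a b] [c d] /= [aE ->]
    [cE ->]|y /= [_ ->]] //.
  - by split=> //; apply: KE; apply/asboolP; exists a.
  - by split; rewrite ?EB.
  - by split; rewrite ?EM.
have [p minp] := minimal_poly_exists grR x.
pose p1 := map_poly fst p.
have p1m : p1 \is monic by rewrite monic_map ?(minp_monic minp).
have p1E i : p1`_i \in E by rewrite coef_map; have [] := minp_coef minp i.
have p2E : map_poly snd p = p1.
  by apply/polyP => i; rewrite !coef_map; have [] := minp_coef minp i.
have sp1 : size p1 = size p.
  by rewrite size_map_poly_id0 // (monicP (minp_monic minp)) oner_neq0.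
(* A second root is enough: the identity of [E] extends by sending [x] to [y], and then to all of
   [L]. *)
suff [y yx py] : exists2 y, y != x & p1.[y] = 0.
  have [|tau galT tauE] := embedding_graph_extend (adjoin_graph grR minp (y := y) _).
    by rewrite p2E.
  exists tau; last by rewrite (tauE x y) //; apply: adjoin_graph_mem.
  case: galT => *; split=> // z zE; apply: tauE; apply: adjoin_graph_sub => //.
have [rs] := closed_field_poly_normal p1; rewrite (monicP p1m) scale1r => prs.
have [/all_pred1P rsx|/allPn[y yrs yx]] := boolP (all (pred1 x) rs); last first.
  by exists y => //; apply/rootP; rewrite prs root_prod_XsubC.
rewrite rsx big_nseq iter_mulr_1 in prs; move: (size rs) prs => [|[|k]] prs.
- by have := minp_root minp; rewrite -/p1 prs expr0 hornerC => /eqP; rewrite oner_eq0.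
- have := EB _ _ (EB _ _ E1 E1) (p1E 0); rewrite prs expr1 coefB coefX coefC.
  by rewrite !subrr !sub0r opprK (negPf xE).
pose u := ('X - x%:P) ^+ k.+1.
have um : u \is monic by rewrite monic_exp ?monicXsubC.
have su : size u = k.+2 by rewrite size_exp_XsubC.
have Enat j : j%:R \in E.
  by apply: KE; apply/asboolP; exists j%:R; rewrite rmorph_nat.
(* Up to the invertible integer [k.+2], [u] is the derivative of [p1]; it still vanishes at [x]. *)
have uE i : u`_i \in E.
  have : (p1^`())`_i = u`_i * k.+2%:R.
    by rewrite prs deriv_exp derivXsubC mul1r coefMn mulr_natr.
  rewrite coef_deriv => /(congr1 (fun z => z / k.+2%:R)).
  rewrite mulfK ?char0 // => <-; apply: EV => //.
  by rewrite -mulr_natr; apply: EM.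
have := minp_min minp (q := map_poly (@diag L) u).
rewrite -sp1 prs size_exp_XsubC size_map_poly su ltnn => /(_ _ _ _)/negP[] //.
- by rewrite monic_map.
- by move=> i; rewrite coef_map; split; rewrite //= uE.
- by rewrite map_fst_diag /u exprS hornerM hornerXsubC subrr mul0r.
Qed.

End Galois.

(** * Galois action on points, and restriction to fields generated by points *)

Section Restriction.
Variable G : cAlgGroup iota.

Lemma point_overT (P : gpt G) : P \in point_over predT.
Proof. exact/forallP. Qed.

Lemma gal_actET (E : {pred L}) sigma (P : gpt G) : {subset base_field iota <= E} ->
  is_gal E predT sigma -> coords (gal_act sigma P) = map_mx sigma (coords P).
Proof.
move=> KE galS; apply: (gal_actE predT_divring _ KE galS) => //.
exact: point_overT.
Qed.

Lemma gal_act_eq (sigma tau : L -> L) (P : gpt G) :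
  (forall i, sigma (coords P 0 i) = tau (coords P 0 i)) ->
  gal_act sigma P = gal_act tau P.
Proof.
move=> st; rewrite /gal_act.
have -> // : map_mx sigma (coords P) = map_mx tau (coords P).
by apply/matrixP => i j; rewrite !mxE ord1 st.
Qed.

Lemma gal_act_id (sigma : L -> L) (P : gpt G) :
  (forall i, sigma (coords P 0 i) = coords P 0 i) -> gal_act sigma P = P.
Proof.
move=> sP; rewrite (@gal_act_eq sigma id) // /gal_act map_mx_id //.
by apply/val_inj/insubdK/(valP P).
Qed.

Lemma gal_act_eq_on (F : {pred L}) (sigma tau : L -> L) (P : gpt G) :
  {in F, sigma =1 tau} -> P \in point_over F -> gal_act sigma P = gal_act tau P.
Proof. by move=> st /forallP PF; apply: gal_act_eq => i; apply: st. Qed.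

Lemma galB (E : {pred L}) sigma : is_gal E predT sigma ->
  {morph sigma : x y / x - y}.
Proof.
move=> galS x y; apply: (addIr (sigma y)).
by rewrite -(galD galS) // !subrK.
Qed.

Lemma galV (E : {pred L}) sigma : is_gal E predT sigma ->
  {morph sigma : x / x^-1}.
Proof.
move=> galS x; have s0 : sigma 0 = 0 by have := galB galS 1 1; rewrite !subrr.
have [->|x0] := eqVneq x 0; first by rewrite invr0 s0 invr0.
by apply/esym/mulr1_eq; rewrite -(Defs.galM galS) // divff ?(gal1 galS).
Qed.

(** With [field_of_points_min], this reduces the comparison of two automorphisms to generators. *)
Lemma gal_equalizer_closed (E : {pred L}) sigma tau : is_gal E predT sigma ->
  is_gal E predT tau -> divring_closed [pred x | sigma x == tau x].
Proof.
move=> galS galT.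
split=> [|x y /eqP xE /eqP yE|x y /eqP xE /eqP yE]; rewrite !inE.
- by rewrite (gal1 galS) (gal1 galT).
- by rewrite (galB galS) (galB galT) xE yE.
- by rewrite (Defs.galM galS) // (Defs.galM galT) // (galV galS) (galV galT) xE yE.
Qed.

Lemma gal_preim_closed (E : {pred L}) sigma (F : {pred L}) : divring_closed F ->
  is_gal E predT sigma -> divring_closed [pred x | sigma x \in F].
Proof.
move=> [F1 FB FV] galS; split=> [|x y|x y]; rewrite !inE.
- by rewrite (gal1 galS).
- by rewrite (galB galS); apply: FB.
- by rewrite (Defs.galM galS) // (galV galS); apply: FV.
Qed.

Lemma field_of_points_min (S : set (gpt G)) (F : {pred L}) :
  divring_closed F -> {subset base_field iota <= F} ->
  (forall P, S P -> P \in point_over F) -> {subset field_of_points S <= F}.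
Proof. by move=> dF KF SF x /asboolP; apply. Qed.

Definition restrict_gal (F : {pred L}) (sigma : L -> L) x :=
  if x \in F then sigma x else x.

(** The elements that [sigma] sends into the field form a field containing the generators. Stability
    of [S] under the inverse of [sigma] is not assumed: surjectivity comes from algebraicity. *)
Lemma gal_restrict (E : {pred L}) (S : set (gpt G)) sigma :
  {subset base_field iota <= E} -> {subset E <= field_of_points S} ->
  is_gal E predT sigma -> (forall P, S P -> S (gal_act sigma P)) ->
  is_gal E (field_of_points S) (restrict_gal (field_of_points S) sigma).
Proof.
move=> KE EF galS SS; set F := field_of_points S.
have dF : divring_closed F := field_of_points_closed S.
have KF : {subset base_field iota <= F} := @base_field_of_points _ _ _ _ S.
have sF : {in F, forall x, sigma x \in F}.
  apply: (field_of_points_min (gal_preim_closed dF galS)).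
    by move=> x xK; change (sigma x \in F); rewrite (gal_fix galS) ?KF //; apply: KE.
  move=> P SP; apply/forallP => i; change (sigma (coords P 0 i) \in F).
  have /forallP := points_over_field (SS _ SP) => /(_ i).
  by rewrite (gal_actET _ KE galS) mxE.
have rE : {in F, restrict_gal F sigma =1 sigma} by move=> x xF; rewrite /restrict_gal xF.
have [F1 FB FV] := dF.
have F0 : 0 \in F by rewrite -(subrr 1) FB.
have FD x y : x \in F -> y \in F -> x + y \in F.
  by move=> xF yF; rewrite -[y]opprK FB // -sub0r FB.
have FM x y : x \in F -> y \in F -> x * y \in F.
  by move=> xF yF; rewrite -[y]invrK FV // -div1r FV.
have rF : {in F, forall x, restrict_gal F sigma x \in F}.
  by move=> x xF; rewrite rE ?sF.
have rD : {in F &, {morph restrict_gal F sigma : x y / x + y}}.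
  by move=> x y xF yF; rewrite !rE ?FD // (galD galS).
have rM : {in F &, {morph restrict_gal F sigma : x y / x * y}}.
  by move=> x y xF yF; rewrite !rE ?FM // (Defs.galM galS).
have rfix : {in E, restrict_gal F sigma =1 id}.
  by move=> x xE; rewrite rE ?(gal_fix galS) // EF.
split=> //.
- by apply: algebraic_endo_surj dF KF rF _ rD rM => x xK; apply/rfix/KE.
- by rewrite rE // (gal1 galS).
- by move=> x xF; rewrite /restrict_gal (negPf xF).
Qed.

End Restriction.
End Embeddings.

(** * The image of the Kummer map *)

Section QuotientMaps.
Variables (K L : fieldType) (iota : {rmorphism K -> L}) (G : cAlgGroup iota).
Variable A : zmodClosed (gpt G).

Fact gam_class_zmod_morphism : zmod_morphism (@gam_class _ _ _ _ A).
Proof. by move=> b c; rewrite /gam_class raddfB. Qed.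
HB.instance Definition _ := GRing.isZmodMorphism.Build (gam A) (gam_quot A)
  (@gam_class _ _ _ _ A) gam_class_zmod_morphism.

Lemma gam_class_eq (b c : gam A) :
  (gam_class b = gam_class c) <-> (b - c \in @A_tors _ _ _ _ A).
Proof.
rewrite Quotient.idealrBE; split=> [bc|/eqP//].
exact/eqP.
Qed.

Lemma gam_class0 (b : gam A) : (gam_class b = 0) <-> (b \in @A_tors _ _ _ _ A).
Proof. by rewrite -[0](raddf0 (@gam_class _ _ _ _ A)) gam_class_eq subr0. Qed.

Lemma gam_class_surj (x : gam_quot A) : exists b, x = gam_class b.
Proof. by exists (repr x); rewrite /gam_class reprK. Qed.

Lemma kummer_hom_exists (g : gam A -> tors G) : zmod_morphism g ->
  (forall b, b \in @A_tors _ _ _ _ A -> g b = 0) ->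
  exists h : kummer_hom A, forall b, h (gam_class b) = g b.
Proof.
move=> gB g0; pose f (x : gam_quot A) := g (repr x).
have fE b : f (gam_class b) = g b.
  apply/eqP; rewrite -subr_eq0 -gB; apply/eqP/g0.
  by apply/gam_class_eq; rewrite /gam_class reprK.
have fB : zmod_morphism f.
  move=> x y; have [b ->] := gam_class_surj x; have [c ->] := gam_class_surj y.
  by rewrite -raddfB !fE gB.
pose h : kummer_hom A := HB.pack f (GRing.isZmodMorphism.Build _ _ f fB).
by exists h.
Qed.

Lemma tors_valB (t u : tors G) : tors_val (t - u) = tors_val t - tors_val u.
Proof. by []. Qed.
Lemma tors_valD (t u : tors G) : tors_val (t + u) = tors_val t + tors_val u.
Proof. by []. Qed.
Lemma tors_valMn (t : tors G) k : tors_val (t *+ k) = tors_val t *+ k.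
Proof. by elim: k => // k IH; rewrite !mulrS tors_valD IH. Qed.
Lemma gam_valB (b c : gam A) : gam_val (b - c) = gam_val b - gam_val c.
Proof. by []. Qed.
Lemma gam_valD (b c : gam A) : gam_val (b + c) = gam_val b + gam_val c.
Proof. by []. Qed.
Lemma gam_valMn (b : gam A) k : gam_val (b *+ k) = gam_val b *+ k.
Proof. by elim: k => // k IH; rewrite !mulrS gam_valD IH. Qed.

End QuotientMaps.

(** * The Kummer image as a closed Galois-stable subgroup *)

Section Kummer.
Variables (K : fieldType) (L : closedFieldType) (iota : {rmorphism K -> L}).
Hypothesis L_algebraic : integralRange iota.
Variables (G : cAlgGroup iota) (A : zmodClosed (gpt G)).
Hypothesis A_rational : {subset A <= point_over (base_field iota)}.

Local Notation K0 := (base_field iota).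
Local Notation Kinf := (K_infty G).
Local Notation KG := (K_Gamma A).

Lemma K_infty_closed : divring_closed Kinf.
Proof. exact: field_of_points_closed. Qed.
Lemma K_Gamma_closed : divring_closed KG.
Proof. exact: field_of_points_closed. Qed.
Lemma base_K_infty : {subset K0 <= Kinf}.
Proof. exact: base_field_of_points. Qed.
Lemma base_K_Gamma : {subset K0 <= KG}.
Proof. exact: base_field_of_points. Qed.
Lemma base_field_closed : divring_closed K0.
Proof.
split=> [|_ _ /asboolP[a ->] /asboolP[b ->]|_ _ /asboolP[a ->] /asboolP[b ->]];
  apply/asboolP.
- by exists 1; rewrite rmorph1.
- by exists (a - b); rewrite rmorphB.
- by exists (a / b); rewrite fmorph_div.
Qed.
Lemma torsion_K_infty (t : gpt G) : t \in torsion G -> t \in point_over Kinf.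
Proof. exact: points_over_field. Qed.
Lemma div_hull_K_Gamma (b : gpt G) : b \in div_hull A -> b \in point_over KG.
Proof. exact: points_over_field. Qed.
Lemma torsion_div_hull (t : gpt G) : t \in torsion G -> t \in div_hull A.
Proof. by move=> tT; have := tors_div_hull A (Tors tT). Qed.
Lemma K_infty_sub : {subset Kinf <= KG}.
Proof.
apply: field_of_points_min K_Gamma_closed base_K_Gamma _ => t tT.
exact/div_hull_K_Gamma/torsion_div_hull.
Qed.

Lemma gal_weaken (E E' : {pred L}) sigma : {subset E' <= E} ->
  is_gal E predT sigma -> is_gal E' predT sigma.
Proof. by move=> E'E []; split=> // x /E'E; auto. Qed.

Lemma gal_comp (E : {pred L}) sigma tau : is_gal E predT sigma ->
  is_gal E predT tau -> is_gal E predT (sigma \o tau).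
Proof.
move=> galS galT; split=> //= [y _||x y _ _|x y _ _|x xE].
- have [z _ <-] := gal_surj galS (isT : y \in predT).
  by have [x _ <-] := gal_surj galT (isT : z \in predT); exists x.
- by rewrite (gal1 galT) (gal1 galS).
- by rewrite (galD galT) ?(galD galS).
- by rewrite (Defs.galM galT) ?(Defs.galM galS).
- by rewrite (gal_fix galT) ?(gal_fix galS).
Qed.

Lemma gal_inj (E : {pred L}) sigma : is_gal E predT sigma -> injective sigma.
Proof.
move=> galS x y sxy; apply/eqP; rewrite -subr_eq0; apply/negP => /negP d0.
have := Defs.galM galS (isT : x - y \in predT) (isT : (x - y)^-1 \in predT).
rewrite divff // (gal1 galS) (galB galS) sxy subrr mul0r => /eqP.
by rewrite oner_eq0.
Qed.

Lemma gal_inverse (E : {pred L}) sigma : is_gal E predT sigma ->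
  exists2 tau, is_gal E predT tau & cancel sigma tau /\ cancel tau sigma.
Proof.
move=> galS; have sinj := gal_inj galS.
have ex y : exists x, sigma x = y.
  by have [x _ xy] := gal_surj galS (isT : y \in predT); exists x.
have [tau tauK] := choice ex; have tauK' : cancel sigma tau.
  by move=> x; apply: sinj; rewrite tauK.
exists tau; last by split.
split=> // [y _||x y _ _|x y _ _|x xE].
- by exists (sigma y); rewrite ?tauK'.
- by apply: sinj; rewrite tauK (gal1 galS).
- by apply: sinj; rewrite tauK (galD galS) // !tauK.
- by apply: sinj; rewrite tauK (Defs.galM galS) // !tauK.
- by apply: sinj; rewrite tauK (gal_fix galS).
Qed.

Section Action.
Variables (sigma : L -> L) (galS : is_gal K0 predT sigma).

Lemma actD : {morph gal_act sigma : P Q / P + Q :> gpt G}.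
Proof.
move=> P Q; have KT : {subset K0 <= (predT : {pred L})} by [].
exact: (gal_actD (predT_divring L) KT (fun x => id) galS (point_overT P) (point_overT Q)).
Qed.

Lemma act0 : gal_act sigma (0 : gpt G) = 0.
Proof. by apply: (addrI (gal_act sigma 0)); rewrite -actD !addr0. Qed.

Lemma actB : {morph gal_act sigma : P Q / P - Q :> gpt G}.
Proof. by move=> P Q; apply: (addIr (gal_act sigma Q)); rewrite -actD !subrK. Qed.

Lemma actMn (P : gpt G) k : gal_act sigma (P *+ k) = gal_act sigma P *+ k.
Proof. by elim: k => [|k IH]; rewrite ?mulr0n ?act0 // !mulrS actD IH. Qed.

Lemma act_rational (P : gpt G) : P \in point_over K0 -> gal_act sigma P = P.
Proof. by move=> /forallP PK; apply: gal_act_id => i; apply: gal_fix galS _ (PK i). Qed.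

Lemma act_torsion (t : gpt G) : t \in torsion G -> gal_act sigma t \in torsion G.
Proof.
move=> /asboolP[k k0 tk]; apply/asboolP; exists k => //.
by rewrite -actMn tk act0.
Qed.

Lemma act_diff (b : gpt G) : b \in div_hull A -> gal_act sigma b - b \in torsion G.
Proof.
move=> /asboolP[k k0 bk]; apply/asboolP; exists k => //.
by rewrite mulrnBl -actMn act_rational ?subrr // A_rational.
Qed.

Lemma act_div_hull (b : gpt G) : b \in div_hull A -> gal_act sigma b \in div_hull A.
Proof.
move=> bG; rewrite -(subrK b (gal_act sigma b)) rpredD //.
exact/torsion_div_hull/act_diff.
Qed.

End Action.

Lemma act_comp sigma tau (P : gpt G) : is_gal K0 predT sigma ->
  is_gal K0 predT tau -> gal_act (sigma \o tau) P = gal_act sigma (gal_act tau P).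
Proof.
move=> galS galT; apply/val_inj => /=.
rewrite (gal_actET _ (fun x => id) (gal_comp galS galT)).
rewrite (gal_actET _ (fun x => id) galS) (gal_actET _ (fun x => id) galT).
by rewrite map_mx_comp.
Qed.

Lemma gal_base sigma : is_gal Kinf predT sigma -> is_gal K0 predT sigma.
Proof. exact: gal_weaken base_K_infty. Qed.

Lemma act_torsion_fix sigma (t : gpt G) : is_gal Kinf predT sigma ->
  t \in torsion G -> gal_act sigma t = t.
Proof.
move=> galS /torsion_K_infty/forallP tK.
by apply: gal_act_id => i; apply: gal_fix galS _ (tK i).
Qed.

(** Automorphisms of K(Gamma) extend to [L]; conversely those of [L] over K_infty restrict, because
    they permute Gamma. All later arguments on the Kummer image go through this form. *)
Lemma kummer_imageP (h : kummer_hom A) : kummer_image h <->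
  exists2 sigma, is_gal Kinf predT sigma &
    forall b : gam A, tors_val (h (gam_class b)) = gal_act sigma b - gam_val b.
Proof.
split=> [[sigma galS hE]|[sigma galS hE]].
  have [tau galT tauE] := gal_extend L_algebraic K_Gamma_closed base_K_infty
    K_infty_sub galS.
  exists tau => // b; rewrite hE (gal_act_eq_on tauE) //.
  exact/div_hull_K_Gamma/gam_valP.
have galS0 := gal_base galS.
exists (restrict_gal KG sigma).
  apply: (gal_restrict L_algebraic base_K_infty K_infty_sub galS) => P.
  exact: act_div_hull.
move=> b; rewrite hE; congr (_ - _).
apply: (@gal_act_eq_on _ _ _ _ KG); last exact/div_hull_K_Gamma/gam_valP.
by move=> x xKG; rewrite /restrict_gal xKG.
Qed.

Lemma kummer_hom_of_gal sigma : is_gal Kinf predT sigma ->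
  exists2 h : kummer_hom A, kummer_image h &
    forall b : gam A, tors_val (h (gam_class b)) = gal_act sigma b - gam_val b.
Proof.
move=> galS; have galS0 := gal_base galS.
pose g (b : gam A) : tors G := Tors (act_diff galS0 (gam_valP b)).
have gB : zmod_morphism g.
  move=> b c; apply/val_inj; rewrite raddfB.
  change (gal_act sigma (gam_val b - gam_val c) - (gam_val b - gam_val c) =
    (gal_act sigma b - gam_val b) - (gal_act sigma c - gam_val c)).
  by rewrite actB // opprD addrACA -opprD.
have [|h hE] := kummer_hom_exists gB.
  move=> b /asboolP[a aA bT]; apply/val_inj => /=.
  rewrite -(subrK a (gam_val b)) actD // (act_torsion_fix galS) //.
  by rewrite act_rational ?A_rational ?subrr.
have hE' b : tors_val (h (gam_class b)) = gal_act sigma b - gam_val b by rewrite hE.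
by exists h => //; apply/kummer_imageP; exists sigma.
Qed.

(** From s1 s2 b - b = s1 (s2 b - b) + (s1 b - b), where s2 b - b is torsion and hence fixed by
    s1. *)
Lemma kummer_imageD (h1 h2 h : kummer_hom A) : (forall x, h x = h1 x + h2 x) ->
  kummer_image h1 -> kummer_image h2 -> kummer_image h.
Proof.
move=> hE /kummer_imageP[s1 g1 h1E] /kummer_imageP[s2 g2 h2E].
apply/kummer_imageP; exists (s1 \o s2) => [|b]; first exact: gal_comp.
have [g1' g2'] := (gal_base g1, gal_base g2).
rewrite hE tors_valD h1E h2E act_comp //.
rewrite -[in RHS](subrK (gam_val b) (gal_act s2 b)) actD // [in RHS](act_torsion_fix g1).
  by rewrite addrC addrA.
exact: act_diff (gam_valP b).
Qed.

Lemma kummer_image0 (h : kummer_hom A) : (forall x, h x = 0) -> kummer_image h.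
Proof.
move=> h0; apply/kummer_imageP; exists id; first by split=> // y; exists y.
by move=> b; rewrite h0 gal_act_id ?subrr.
Qed.

(** Conjugation: with rho inverse to tau and c = rho b, one has tau sigma rho b - b = tau (sigma c -
    c), and c has the class of b since rho b - b is torsion. *)
Lemma kummer_image_stable tau (v h : kummer_hom A) : Gal_infty G tau ->
  kummer_image v -> (forall x, h x = tors_act tau (v x)) -> kummer_image h.
Proof.
move=> galT /kummer_imageP[sigma galS vE] hE.
have [tau' galT' tauE] := gal_extend L_algebraic K_infty_closed (fun x => id)
  base_K_infty galT.
have [rho galR [rhoK tauK]] := gal_inverse galT'.
have galS0 := gal_base galS.
have galC : is_gal K0 predT (tau' \o (sigma \o rho)).
  exact/(gal_comp galT')/gal_comp.
apply/kummer_imageP; exists (tau' \o (sigma \o rho)).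
  (* The conjugate still fixes K_infty pointwise because [tau] maps K_infty onto itself. *)
  case: galC => *; split=> // x xK /=.
  have [u uK <-] := gal_surj galT xK.
  by rewrite -tauE // rhoK (gal_fix galS).
move=> b; rewrite act_comp //; last exact: gal_comp.
rewrite act_comp //.
have cG := act_div_hull galR (gam_valP b).
pose c := Gam cG.
have tc : gal_act tau' (gam_val c) = gam_val b.
  by rewrite -act_comp // gal_act_id // => i; rewrite /= tauK.
have bc : gam_class b = gam_class c.
  apply/gam_class_eq/asboolP; exists 0; rewrite ?rpred0 // subr0 -opprB rpredN.
  exact: act_diff galR _ (gam_valP b).
rewrite hE tors_actE // bc -[X in _ = _ - X]tc -actB //.
rewrite -[X in gal_act tau' X]/(gal_act sigma (gam_val c) - gam_val c) -vE.
rewrite (gal_act_eq_on tauE) //.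
by apply: torsion_K_infty; case: (v _).
Qed.

(* A homomorphism that is locally of the form [sigma - 1] is so globally: the
   automorphisms [sigma_ q] obtained from the [q]-torsion are determined on the
   field generated by the points whose class has order dividing [q]. *)
Lemma kummer_image_closed (h : kummer_hom A) :
  (forall q, (0 < q)%N -> exists2 v : kummer_hom A, kummer_image v &
    forall x, x *+ q = 0 -> h x = v x) -> kummer_image h.
Proof.
move=> hV.
pose Gq q : set (gpt G) :=
  [set P | exists2 b : gam A, gam_val b = P & gam_class b *+ q = 0].
have /choice[sig sigP] : forall q, exists sigma, (0 < q)%N ->
    is_gal Kinf predT sigma /\ forall b : gam A, gam_class b *+ q = 0 ->
    tors_val (h (gam_class b)) = gal_act sigma b - gam_val b.
  move=> q; case: (posnP q) => [_|q0]; first by exists id.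
  have [v /kummer_imageP[sigma galS vE] hv] := hV q q0.
  by exists sigma => _; split=> // b bq; rewrite hv.
pose F q := field_of_points (Gq q).
have dF q : divring_closed (F q) := field_of_points_closed (Gq q).
have KF q : {subset K0 <= F q} := @base_field_of_points _ _ _ _ (Gq q).
have Fmono q q' : (q %| q')%N -> {subset F q <= F q'}.
  move=> /dvdnP[k ->]; apply: (field_of_points_min (dF _) (KF _)) => P [b bP bq].
  apply: points_over_field; exists b => //.
  by rewrite mulnC mulrnA bq mul0rn.
(* On the generators [b] of [F q] both automorphisms are b |-> b + h [b]. *)
have agree q q' : (0 < q')%N -> (q %| q')%N -> {in F q, sig q =1 sig q'}.
  move=> q'0 qq'; have q0 := dvdn_gt0 q'0 qq'.
  have [[galS hS] [galS' hS']] := (sigP q q0, sigP q' q'0).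
  suff sub : {subset F q <= [pred x | sig q x == sig q' x]}.
    by move=> x /sub /eqP.
  apply: (field_of_points_min (gal_equalizer_closed galS galS')).
    by move=> x xK; rewrite inE !(gal_fix (gal_base _)).
  move=> _ [b <- bq]; apply/forallP => i; rewrite inE.
  have bq' : gam_class b *+ q' = 0.
    by case/dvdnP: qq' => k ->; rewrite mulnC mulrnA bq mul0rn.
  have /addIr/(congr1 (fun P => coords P 0 i)) := etrans (esym (hS b bq)) (hS' b bq').
  rewrite (gal_actET _ base_K_infty galS) (gal_actET _ base_K_infty galS').
  by rewrite !mxE => ->.
have FKG q : {subset F q <= KG}.
  apply: (field_of_points_min K_Gamma_closed base_K_Gamma) => _ [b <- _].
  exact/div_hull_K_Gamma/gam_valP.
(* K(Gamma) is the union of the [F q], directed by divisibility, since every class has finite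
   order. *)
have KGF : {subset KG <= [pred x | `[< exists2 q, (0 < q)%N & x \in F q >]]}.
  have FF q q' x : x \in F q -> x \in F (q * q')%N /\ x \in F (q' * q)%N.
    by move=> xF; split; apply: Fmono xF; [exact: dvdn_mulr|exact: dvdn_mull].
  apply: field_of_points_min.
  - split=> [|x y /asboolP[q q0 xF] /asboolP[q' q'0 yF]|x y /asboolP[q q0 xF]
      /asboolP[q' q'0 yF]]; apply/asboolP.
    + by exists 1%N => //; have [] := dF 1%N.
    + exists (q * q')%N; first by rewrite muln_gt0 q0.
      have [_ FB _] := dF (q * q')%N.
      by apply: FB; [have [] := FF q q' x xF|have [] := FF q' q y yF].
    + exists (q * q')%N; first by rewrite muln_gt0 q0.
      have [_ _ FV] := dF (q * q')%N.
      by apply: FV; [have [] := FF q q' x xF|have [] := FF q' q y yF].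
  - by move=> x xK; apply/asboolP; exists 1%N => //; apply: KF.
  move=> P PG; have /asboolP[q q0 Pq] := PG; apply/forallP => i.
  apply/asboolP; exists q => //; suff /forallP : P \in point_over (F q) by apply.
  apply: points_over_field; exists (Gam PG) => //.
  rewrite -raddfMn; apply/gam_class0/asboolP; exists (P *+ q) => //.
  by rewrite gam_valMn subrr rpred0.
have /choice[ord ordP] : forall x, exists q, x \in KG -> (0 < q)%N /\ x \in F q.
  move=> x; have [xKG|_] := boolP (x \in KG); last by exists 0%N.
  by have /asboolP[q q0 xF] := KGF x xKG; exists q.
(* [ord x] is any level containing [x]; by [agree] the value does not depend on the choice. *)
pose s x := if x \in KG then sig (ord x) x else x.
have sE q x : (0 < q)%N -> x \in F q -> s x = sig q x.
  move=> q0 xF; have xKG := FKG q x xF; rewrite /s xKG.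
  have [o0 xo] := ordP x xKG.
  have qo0 : (0 < ord x * q)%N by rewrite muln_gt0 o0.
  by rewrite (agree _ (ord x * q)%N) ?dvdn_mulr // (agree q (ord x * q)%N) ?dvdn_mull.
have sig_stable q x : (0 < q)%N -> x \in KG -> sig q x \in KG.
  move=> q0 xKG; have [galS _] := sigP q q0.
  have := gal_stable (gal_restrict L_algebraic base_K_infty K_infty_sub galS
     (act_div_hull (gal_base galS))) xKG.
  by rewrite /restrict_gal xKG.
have common x y : x \in KG -> y \in KG ->
    exists q, [/\ (0 < q)%N, x \in F q & y \in F q].
  move=> xKG yKG; have [[qx0 xF] [qy0 yF]] := (ordP x xKG, ordP y yKG).
  exists (ord x * ord y)%N; split; first by rewrite muln_gt0 qx0.
    by apply: Fmono xF; rewrite dvdn_mulr.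
  by apply: Fmono yF; rewrite dvdn_mull.
have FD q x y : x \in F q -> y \in F q -> x + y \in F q.
  have [F1 FB _] := dF q; move=> xF yF.
  by rewrite -[y]opprK FB // -sub0r FB // -(subrr 1) FB.
have FM q x y : x \in F q -> y \in F q -> x * y \in F q.
  have [F1 _ FV] := dF q; move=> xF yF.
  by rewrite -[y]invrK FV // -div1r FV.
have sKG : {in KG, forall x, s x \in KG}.
  by move=> x xKG; rewrite /s xKG sig_stable //; have [] := ordP x xKG.
have sD : {in KG &, {morph s : x y / x + y}}.
  move=> x y xKG yKG; have [q [q0 xF yF]] := common x y xKG yKG.
  by rewrite !(sE q) ?FD // (galD (sigP q q0).1).
have sM : {in KG &, {morph s : x y / x * y}}.
  move=> x y xKG yKG; have [q [q0 xF yF]] := common x y xKG yKG.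
  by rewrite !(sE q) ?FM // (Defs.galM (sigP q q0).1).
have sfix : {in Kinf, s =1 id}.
  move=> x xK; have xKG := K_infty_sub xK; rewrite /s xKG.
  have [o0 _] := ordP x xKG; by rewrite (gal_fix (sigP _ o0).1).
exists s.
  split=> //.
  - apply: (algebraic_endo_surj L_algebraic K_Gamma_closed base_K_Gamma sKG _ sD sM).
    by move=> x xK; apply/sfix/base_K_infty.
  - by rewrite sfix //; have [] := K_infty_closed.
  - by move=> x /negPf xKG; rewrite /s xKG.
move=> b; have [q q0 bq] : exists2 q, (0 < q)%N & gam_class b *+ q = 0.
  have /asboolP[q q0 bq] := gam_valP b; exists q => //.
  rewrite -raddfMn; apply/gam_class0/asboolP; exists (gam_val b *+ q) => //.
  by rewrite gam_valMn subrr rpred0.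
rewrite (sigP q q0).2 //; congr (_ - _).
apply: (@gal_act_eq_on _ _ _ _ (F q)) => [x xF|]; first by rewrite (sE q).
by apply: points_over_field; exists b.
Qed.

End Kummer.

(** * Classes fixed by the Galois group of K_infty *)

Section Cohomology.
Variables (K : fieldType) (L : closedFieldType) (iota : {rmorphism K -> L}).
Hypothesis L_algebraic : integralRange iota.
Hypothesis char0 : forall k, (0 < k)%N -> k%:R != 0 :> L.
Variables (G : cAlgGroup iota) (A : zmodClosed (gpt G)).
Hypothesis A_rational : {subset A <= point_over (base_field iota)}.

Local Notation K0 := (base_field iota).
Local Notation Kinf := (K_infty G).

(** Coordinates are normalised, so a fixed point has fixed coordinates, and [gal_moves] places these
    in [E]. *)
Lemma fixed_point_over (E : {pred L}) (P : gpt G) : divring_closed E ->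
  {subset K0 <= E} -> (forall sigma, is_gal E predT sigma -> gal_act sigma P = P) ->
  P \in point_over E.
Proof.
move=> dE KE fixP; apply/forallP => i; apply: contraT => xE.
have [tau galT /eqP[]] := gal_moves L_algebraic dE KE char0 xE.
have /(congr1 (fun P => coords P 0 i)) := fixP tau galT.
by rewrite (gal_actET _ KE galT) mxE.
Qed.

Lemma fixed_class_exponent (d e : nat) (b : gam A) :
  divisibility_parameter A d -> kills_H1 G e ->
  (forall sigma, is_gal Kinf predT sigma -> gal_act sigma b = gam_val b) ->
  gam_class b *+ (d * e) = 0.
Proof.
move=> [d0 ddiv] eH1 fixb.
have bK : gam_val b \in point_over Kinf.
  exact: fixed_point_over (K_infty_closed G) (@base_K_infty _ _ _ G) fixb.
have ext sigma : Gal_infty G sigma ->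
    exists2 sigma', is_gal K0 predT sigma' & {in Kinf, sigma' =1 sigma}.
  move=> galS; exact: (gal_extend L_algebraic (K_infty_closed G) (fun x => id)
    (@base_K_infty _ _ _ G) galS).
(* On [Gal_infty] the default 0 is never taken, by [cP]. *)
pose c sigma : tors G := insubd (0 : tors G) (gal_act sigma (gam_val b) - gam_val b).
have cE sigma : gal_act sigma (gam_val b) - gam_val b \in torsion G ->
    tors_val (c sigma) = gal_act sigma (gam_val b) - gam_val b.
  by move=> bT; apply: insubdK.
have cP sigma : Gal_infty G sigma ->
    tors_val (c sigma) = gal_act sigma (gam_val b) - gam_val b.
  move=> /ext[sigma' galS' sE]; apply: cE; rewrite -(gal_act_eq_on sE bK).
  exact: act_diff A_rational _ galS' _ (gam_valP b).
have [||t tE] := eH1 c.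
- move=> sigma tau; rewrite !inE => galS galT.
  have [[s' galS' sE] [t' galT' tE]] := (ext _ galS, ext _ galT).
  have stE : {in Kinf, s' \o t' =1 sigma \o tau}.
    by move=> x xK /=; rewrite tE // sE // (gal_stable galT).
  apply/val_inj.
  change (tors_val (c (sigma \o tau)) =
    tors_val (c sigma) + tors_val (tors_act sigma (c tau))).
  rewrite tors_actE // (cP _ galS) (cP _ galT) cE -(gal_act_eq_on stE bK); last first.
    exact: act_diff A_rational _ (gal_comp galS' galT') _ (gam_valP b).
  have dT := act_diff A_rational galT' (gam_valP b).
  rewrite act_comp // -(gal_act_eq_on sE bK) -(gal_act_eq_on tE bK).
  rewrite -(gal_act_eq_on sE (torsion_K_infty dT)) actB //.
  by rewrite [RHS]addrC addrA subrK.
- move=> sigma; rewrite inE => galS.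
  (* For continuity, the value at [sigma] depends only on the images of the finitely many
     coordinates of [b]. *)
  exists [seq coords (gam_val b) 0 i | i : 'I_(qp_dim (cag_var G)).+1]; split.
    by move=> _ /codomP[i ->]; apply: (forallP bK).
  move=> tau; rewrite inE => galT tS; apply/val_inj.
  change (tors_val (c tau) = tors_val (c sigma)); rewrite !cP //.
  by rewrite (@gal_act_eq _ _ _ _ tau sigma) // => i; apply/tS/codom_f.
pose P : gpt G := gam_val b *+ e - tors_val t.
(* By the coboundary relation, [b *+ e] and [t] change by the same amount under every
   automorphism. *)
have PK : P \in point_over K0.
  apply: (fixed_point_over (base_field_closed iota)) => // sigma' galS'.
  have galS : Gal_infty G (restrict_gal Kinf sigma').
    apply: (gal_restrict L_algebraic _ (@base_K_infty _ _ _ G) galS') => // Q.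
    exact: act_torsion.
  have sE : {in Kinf, sigma' =1 restrict_gal Kinf sigma'}.
    by move=> x xK; rewrite /restrict_gal xK.
  have tK : tors_val t \in point_over Kinf by apply: torsion_K_infty; case: (t).
  have := congr1 (@tors_val _ _ _ G) (tE _ (mem_set galS)).
  rewrite tors_valMn cP // tors_valB tors_actE //.
  rewrite -(gal_act_eq_on sE bK) -(gal_act_eq_on sE tK) mulrnBl => stb.
  rewrite /P actB // actMn //; apply/eqP; rewrite -subr_eq0.
  by rewrite opprD addrACA -opprD stb subrr.
have PG : P \in div_hull A.
  by rewrite rpredB ?rpredMn ?(gam_valP b) //; apply: torsion_div_hull; case: (t).
have [a [u [aA uT _ PE]]] := ddiv P PG PK.
rewrite -raddfMn; apply/gam_class0/asboolP; exists a => //.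
have -> : gam_val (b *+ (d * e)) - a = tors_val t *+ d + u.
  rewrite gam_valMn mulnC mulrnA -(subrK (tors_val t) (gam_val b *+ e)) mulrnDl.
  by rewrite -/P PE addrAC [a + u]addrC addrK addrC.
by rewrite rpredD ?rpredMn //; case: (t).
Qed.

End Cohomology.

(** * Duality for homomorphisms into (Q/Z)^s *)

Section Lattice.

Local Notation ratm := (map_mx (intr : int -> rat)).

Lemma int_ratm_mul k r (N : 'M[int]_(k, r)) (z : 'cV[rat]_r) :
  (forall j, z j 0 \is a Num.int) -> forall i, (ratm N *m z) i 0 \is a Num.int.
Proof.
move=> zZ i; rewrite mxE rpred_sum // => j _.
by rewrite rpredM // mxE intr_int.
Qed.

(* After a change of bases [N] is diagonal, and the condition on [f] is tested
   on the vectors [e_j / d_j]. *)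
Lemma int_row_space_dual k r (N : 'M[int]_(k, r)) (f : 'rV[int]_r) :
  (forall x : 'cV[rat]_r, (forall i, (ratm N *m x) i 0 \is a Num.int) ->
     (ratm f *m x) 0 0 \is a Num.int) ->
  exists y, f = y *m N.
Proof.
move=> fN; have [L uL [R uR [d _ NE]]] := int_Smith_normal_form N.
set D := \matrix_(i, j) _ in NE.
pose f' := f *m invmx R.
(* The diagonal of [D], continued by 0 on the columns beyond its [k] rows. *)
pose del (j : 'I_r) : int := if (j < k)%N then d`_j else 0.
have test (t : rat) j : (forall i : 'I_k, (D i j)%:~R * t \is a Num.int) ->
    (f' 0 j)%:~R * t \is a Num.int.
  move=> tD; pose x : 'cV[rat]_r := ratm (invmx R) *m (t *: delta_mx j 0).
  have xE m (B : 'M[int]_(m, r)) i :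
      (ratm B *m x) i 0 = ((B *m invmx R) i j)%:~R * t.
    rewrite /x mulmxA -map_mxM -scalemxAr mxE -colE !mxE mulrC //.
  have := fN x; rewrite xE -/f' => -> // i; rewrite NE -mulmxA.
  rewrite map_mxM -mulmxA; apply: int_ratm_mul => l.
  by rewrite xE mulmxK.
have ddvd j : (del j %| f' 0%R j)%Z.
  have colD i : D i j = del j *+ (i == j :> nat).
    rewrite mxE /del; case: eqP => [ij|_]; last by rewrite !mulr0n.
    by rewrite -ij ltn_ord.
  (* Over a zero column every rational is a legitimate test value, and 1 / (2 f'_j) would produce
     1/2. *)
  have [dj0|dj0] := eqVneq (del j) 0.
    rewrite dj0 dvd0z; apply: contraT => fj0.
    have := test (2 * (f' 0 j)%:~R)^-1 j.
    have -> : (f' 0 j)%:~R * (2 * (f' 0 j)%:~R)^-1 = 2^-1 :> rat.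
      by rewrite invfM mulrCA divff ?mulr1 ?intr_eq0.
    move=> half; suff : (2^-1 : rat) \is a Num.int by rewrite Qint_def.
    by apply: half => i; rewrite colD dj0 mul0rn mul0r.
  have := test ((del j)%:~R^-1) j => /(_ _)/intrP[|m].
    move=> i; rewrite colD; case: (_ == _); rewrite ?mulr1n ?mulr0n ?mul0r //.
    by rewrite divff ?intr_eq0.
  move/(canRL (mulfVK _)) => fE; apply/dvdzP; exists m.
  by apply/(@intr_inj rat); rewrite fE ?intr_eq0 // intrM.
pose y' : 'rV[int]_k :=
  \row_i if insub (i : nat) is Some j then (f' 0%R j %/ d`_i)%Z else 0.
exists (y' *m invmx L); rewrite NE -!mulmxA mulKmx // mulmxA.
suff -> : y' *m D = f' by rewrite mulmxKV.
apply/rowP => j; rewrite mxE.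
have := ddvd j; rewrite /del; case: ltnP => [jk dj|kj].
  rewrite (bigD1 (Ordinal jk)) //= big1 ?addr0 => [|i ij].
    by rewrite [y' _ _]mxE [D _ _]mxE /= (valK j) eqxx mulr1n divzK.
  rewrite mxE [D _ _]mxE; case: eqP => [ij'|_]; last by rewrite mulr0n mulr0.
  by case/eqP: ij; apply: val_inj.
rewrite dvd0z => /eqP ->; rewrite big1 // => i _.
rewrite [D _ _]mxE; case: eqP => [ij|_]; last by rewrite mulr0n mulr0.
by have := ltn_ord i; rewrite ij ltnNge kj.
Qed.

(** Since [Lam] contains q Z^r, it is the row space of a finite matrix: its own representatives with
    entries in [0, q[, stacked on q times the identity. *)
Lemma finite_index_dual r q (Lam : set 'rV[int]_r) (f : 'rV[int]_r) :
  (0 < q)%N -> (forall f g, Lam f -> Lam g -> Lam (f + g)) ->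
  (forall f, Lam (f *~ q)) ->
  (forall x : 'cV[rat]_r, (forall g, Lam g -> (ratm g *m x) 0 0 \is a Num.int) ->
     (ratm f *m x) 0 0 \is a Num.int) ->
  Lam f.
Proof.
move=> q0 LamD Lamq fdual.
have Lam0 : Lam 0 by have := Lamq 0; rewrite mul0rz.
have LamMn g k : Lam g -> Lam (g *+ k).
  by move=> Lg; elim: k => [|k IH]; rewrite ?mulr0n // mulrS; apply: LamD.
have LamMz g c : Lam g -> Lam (g *~ c).
  move=> Lg; rewrite (divz_eq c q) mulrzDr; apply: LamD.
    by rewrite mulrzA; apply: Lamq.
  have : (0 <= c %% q)%Z by rewrite modz_ge0 // -lt0n.
  by case: (c %% q)%Z => // k _; rewrite -pmulrn; apply: LamMn.
pose lift (g : 'rV['I_q]_r) : 'rV[int]_r := map_mx (fun i : 'I_q => (i : nat)%:Z) g.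
pose P := [pred g | `[< Lam (lift g) >]].
pose N1 := \matrix_(i < #|P|) lift (enum_val i).
pose N := col_mx N1 (q%:Z%:M : 'M_r).
have LamN i : Lam (row i N).
  case: (split_ordP i) => j ->.
    by rewrite rowKu rowK; apply/asboolP; exact: (enum_valP j).
  rewrite rowKd -scalemx1 linearZ /= -[X in X *: _]intz scaler_int.
  exact: Lamq.
have [|y ->] := @int_row_space_dual _ _ N f.
  move=> x Nx; apply: fdual => g Lg.
  have qx j : q%:R * x j 0 \is a Num.int.
    have := Nx (rshift _ j); rewrite map_col_mx mul_col_mx col_mxEd.
    by rewrite map_scalar_mx mul_scalar_mx mxE.
  pose g' : 'rV['I_q]_r := \row_j Ordinal (ltn_pmod `|(g 0%R j %% q)%Z|%N q0).
  pose gq : 'rV[int]_r := \row_j (g 0%R j %/ q)%Z.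
  have gE : g = lift g' + gq *~ q.
    apply/rowP => j; rewrite -scaler_int !mxE /= {1}(divz_eq (g 0 j) q) addrC.
    rewrite modn_small; last first.
      by rewrite -ltz_nat gez0_abs ?modz_ge0 ?ltz_pmod // -lt0n.
    by rewrite gez0_abs ?modz_ge0 -?lt0n // intz mulrC.
  have Lg' : g' \in P.
    apply/asboolP; have -> : lift g' = g + (- gq) *~ q by rewrite gE mulNrz addrK.
    exact: LamD.
  have := Nx (lshift _ (enum_rank_in Lg' g')).
  rewrite map_col_mx mul_col_mx col_mxEu.
  have -> : (ratm N1 *m x) (enum_rank_in Lg' g') 0 = (ratm (lift g') *m x) 0 0.
    rewrite !mxE; apply: eq_bigr => j _; congr (_ * _).
    by rewrite [LHS]mxE [in LHS]mxE enum_rankK_in // [RHS]mxE.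
  move=> g'x; rewrite gE map_mxD mulmxDl mxE rpredD // -scaler_int map_mxZ.
  rewrite -scalemxAl scalemxAr; apply: int_ratm_mul => j.
  by rewrite mxE intz; apply: qx.
rewrite mulmx_sum_row; elim/big_ind: _ => // i _.
by rewrite -[y 0 i]intz scaler_int; apply: LamMz.
Qed.

End Lattice.

Fact qz_zmod_morphism : zmod_morphism qz.
Proof. by move=> x y; rewrite /qz raddfB. Qed.
HB.instance Definition _ := GRing.isZmodMorphism.Build rat QZ qz qz_zmod_morphism.

Lemma qz_eq x y : (qz x = qz y) <-> (x - y \is a Num.int).
Proof.
have -> : (x - y \is a Num.int) = (x - y \in Defs.ratz) by [].
rewrite Quotient.idealrBE; split=> [xy|/eqP//].
exact/eqP.
Qed.

Lemma qz_eq0 x : (qz x = 0) <-> (x \is a Num.int).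
Proof. by rewrite -[0](raddf0 qz) qz_eq subr0. Qed.

Lemma qz_surj u : exists x, u = qz x.
Proof. by exists (repr u); rewrite /qz reprK. Qed.

Lemma qz_mx_surj k (u : 'cV[QZ]_k) : exists x, u = map_mx qz x.
Proof.
exists (map_mx repr u); apply/colP => i.
by rewrite !mxE /qz reprK.
Qed.

Lemma qz_mx_eq0 k (x : 'cV[rat]_k) :
  (map_mx qz x = 0) <-> (forall i, x i 0 \is a Num.int).
Proof.
split=> [x0 i|x0]; first by apply/qz_eq0; have /colP/(_ i) := x0; rewrite !mxE.
by apply/colP => i; rewrite !mxE; apply/qz_eq0.
Qed.

(** * A stable closed subgroup of Hom (X, T) with small annihilator is large *)

Section Duality.
Variables (r s : nat) (X T : zmodType).
Variables (xi : {additive 'cV[rat]_r -> X}) (psi : {additive 'cV[QZ]_s -> T}).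
Hypothesis xi_surj : forall x, exists y, x = xi y.
Hypothesis xi_ker : forall y, (xi y = 0) <-> (forall j, y j 0 \is a Num.int).
Hypothesis psi_bij : bijective psi.
Implicit Types (y : 'cV[rat]_r) (u : 'cV[rat]_s).

Local Notation ratm := (map_mx (intr : int -> rat)).

Lemma hom_exists (g : 'cV[rat]_r -> T) : zmod_morphism g ->
  (forall y, (forall j, y j 0 \is a Num.int) -> g y = 0) ->
  exists h : {additive X -> T}, forall y, h (xi y) = g y.
Proof.
move=> gB g0; have [rep repE] := choice xi_surj.
have fE y : g (rep (xi y)) = g y.
  apply/eqP; rewrite -subr_eq0 -gB; apply/eqP/g0/xi_ker.
  by rewrite raddfB -repE subrr.
have fB : zmod_morphism (g \o rep).
  move=> a b; rewrite /= -gB; apply/eqP; rewrite -subr_eq0 -gB.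
  by apply/eqP/g0/xi_ker; rewrite !(raddfB xi) -!repE subrr.
pose h : {additive X -> T} :=
  HB.pack (g \o rep) (GRing.isZmodMorphism.Build _ _ (g \o rep) fB).
by exists h => y; rewrite /= fE.
Qed.

(** Integer matrices represent homomorphisms at a finite level. The argument is a rational vector,
    so that products with matrices are ordinary ones and reduction modulo Z comes last. *)
Definition mxhom (a : 'M[int]_(s, r)) y : T := psi (map_mx qz (ratm a *m y)).

Lemma mxhomB a : zmod_morphism (mxhom a).
Proof. by move=> y z; rewrite /mxhom mulmxBr map_mxB raddfB. Qed.

Lemma mxhom_int a y : (forall j, y j 0 \is a Num.int) -> mxhom a y = 0.
Proof.
move=> yZ; rewrite /mxhom; have -> : map_mx qz (ratm a *m y) = 0.
  by apply/qz_mx_eq0/int_ratm_mul.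
by rewrite raddf0.
Qed.

Lemma mxhomD a b y : mxhom (a + b) y = mxhom a y + mxhom b y.
Proof. by rewrite /mxhom map_mxD mulmxDl map_mxD raddfD. Qed.

Lemma mxhomMz a k y : mxhom (a *~ k%:Z) y = mxhom a (y *+ k).
Proof.
by rewrite /mxhom -!scaler_nat -!scaler_int map_mxZ /= -scalemxAl -scalemxAr intz.
Qed.

Lemma xiMn0 y q : (xi y *+ q = 0) <-> (forall j, y j 0 *+ q \is a Num.int).
Proof.
rewrite -raddfMn xi_ker; split=> yq j; have := yq j.
  by rewrite -scaler_nat mxE mulr_natl.
by rewrite -scaler_nat mxE mulr_natl.
Qed.

Lemma psi_inj : injective psi. Proof. exact: bij_inj. Qed.

(** X[q] is generated by the classes of the e_j / q, whose images are killed by q and so have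
    coordinates c / q. *)
Lemma hom_mxhom (h : {additive X -> T}) q : (0 < q)%N ->
  exists a, forall y, xi y *+ q = 0 -> h (xi y) = mxhom a y.
Proof.
move=> q0; have [psi' psiK psiK'] := psi_bij.
have q0' : q%:R != 0 :> rat by rewrite pnatr_eq0 -lt0n.
pose e j : 'cV[rat]_r := q%:R^-1 *: delta_mx j 0.
have exc i j : exists c : int,
    psi' (h (xi (e j))) i 0 = qz (c%:~R / q%:R).
  have [x xE] := qz_mx_surj (psi' (h (xi (e j)))); rewrite xE mxE.
  have : xi (e j) *+ q = 0.
    apply/xiMn0 => k; rewrite -[X in X \is a _]mulr_natr !mxE mulrAC mulVf // mul1r.
    by case: (_ && _).
  move/(congr1 h); rewrite raddf0 raddfMn => /(congr1 psi').
  have -> : psi' 0 = 0 by rewrite -(raddf0 psi) psiK.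
  rewrite -[h _]psiK' xE -raddfMn psiK -raddfMn => /qz_mx_eq0/(_ i).
  rewrite -scaler_nat mxE mulrC => /intrP[c cE].
  by exists c; rewrite -cE mulfK.
have /choice[a aE] : forall ij : 'I_s * 'I_r, exists c : int,
    psi' (h (xi (e ij.2))) ij.1 0 = qz (c%:~R / q%:R).
  by case=> i j; apply: exc.
exists (\matrix_(i, j) a (i, j)) => y /xiMn0 yq.
have /choice[z zE] : forall j, exists z : int, y j 0 = z%:~R / q%:R.
  move=> j; have /intrP[z zE] := yq j; exists z.
  by rewrite -zE -(mulr_natr (y j 0)) mulfK.
have -> : y = \sum_j e j *~ z j.
  apply/colP => i; rewrite summxE (bigD1 i) //= big1 ?addr0 => [|j ji].
    by rewrite -scaler_int !mxE !eqxx mulr1 zE.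
  by rewrite -scaler_int !mxE eq_sym (negPf ji) !mulr0.
rewrite !raddf_sum /=.
have -> : mxhom (\matrix_(i, j) a (i, j)) (\sum_j e j *~ z j) =
    \sum_j mxhom (\matrix_(i, j) a (i, j)) (e j) *~ z j.
  pose mh : {additive 'cV[rat]_r -> T} := HB.pack (mxhom (\matrix_(i, j) a (i, j)))
    (GRing.isZmodMorphism.Build _ _ (mxhom (\matrix_(i, j) a (i, j))) (mxhomB _)).
  rewrite -[mxhom _]/(mh : _ -> _) raddf_sum; apply: eq_bigr => j _.
  by rewrite raddfMz.
apply: eq_bigr => j _; rewrite !raddfMz; congr (_ *~ _).
rewrite -[LHS]psiK' /mxhom; congr (psi _); apply/colP => i; rewrite [LHS](aE (i, j)) /=.
rewrite mxE /e -scalemxAr -colE !mxE mulrC //.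
Qed.

Variable V : set {additive X -> T}.
Hypothesis V0 : forall h : {additive X -> T}, (forall x, h x = 0) -> V h.
Hypothesis VD : forall h1 h2 h : {additive X -> T},
  (forall x, h x = h1 x + h2 x) -> V h1 -> V h2 -> V h.
Hypothesis V_closed : forall h : {additive X -> T},
  (forall q, (0 < q)%N -> exists2 v, V v & forall x, x *+ q = 0 -> h x = v x) ->
  V h.
Variables (n D : nat).
Hypotheses (n_gt0 : (0 < n)%N) (D_gt0 : (0 < D)%N).
Hypothesis V_stable : forall q (i j : 'I_s), (0 < q)%N -> exists2 beta : T -> T,
  (forall v, V v -> exists2 w, V w & forall x, w x = beta (v x)) &
  forall u, (forall k, u k 0 *+ q \is a Num.int) ->
    beta (psi (map_mx qz u)) = psi (map_mx qz (delta_mx i j *m u)) *+ n.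
Hypothesis V_ann : forall x, (forall v, V v -> v x = 0) -> x *+ D = 0.

Section Level.
Variables (q : nat) (q_gt0 : (0 < q)%N).

(** The image of [V] in Mat_{s x r}(Z/q), lifted to a lattice of integer matrices containing q
    Mat. *)
Definition Vmx : set 'M[int]_(s, r) :=
  [set a | exists2 v, V v & forall y, xi y *+ q = 0 -> v (xi y) = mxhom a y].

Lemma VmxD a b : Vmx a -> Vmx b -> Vmx (a + b).
Proof.
move=> [v Vv va] [w Vw wb].
exists (v \+ w : {additive X -> T}); first exact: VD Vv Vw.
by move=> y yq; rewrite mxhomD -va // -wb.
Qed.

Lemma VmxMq a : Vmx (a *~ q).
Proof.
exists (\0 : {additive X -> T}); first exact: V0.
move=> y /xiMn0 yq /=.
by rewrite mxhomMz mxhom_int // => j; have := yq j; rewrite -scaler_nat mxE mulr_natl.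
Qed.

Lemma Vmx0 : Vmx 0.
Proof. by have := VmxMq 0; rewrite mul0rz. Qed.

Lemma Vmx_delta i j a : Vmx a -> Vmx ((delta_mx i j *m a) *+ n).
Proof.
move=> [v Vv va]; have [beta bV bE] := V_stable i j q_gt0.
have [w Vw wE] := bV v Vv; exists w => // y yq; rewrite wE va // /mxhom bE.
  rewrite -raddfMn -raddfMn; congr (psi _); congr (map_mx qz _).
  rewrite -!scaler_nat map_mxZ /= map_mxM /= map_delta_mx -scalemxAl rmorph_nat.
  by rewrite mulmxA.
move=> k; have /xiMn0 yq' := yq; have := @int_ratm_mul _ _ a (y *+ q) _ k.
rewrite -scaler_nat -scalemxAr mxE mulr_natl; apply=> j'.
by rewrite mxE mulr_natl.
Qed.

(** Rows [f] such that n f, put in any row of an otherwise zero matrix, gives an element of [Vmx]: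
    the factor n lost to the matrix units is absorbed here. *)
Definition Vrow : set 'rV[int]_r :=
  [set f | forall i, Vmx ((delta_mx i 0 *m f) *+ n)].

Lemma VrowMq (g : 'rV[int]_r) : Vrow (g *~ q).
Proof.
move=> i; rewrite -scaler_int -scalemxAr -scaler_nat scalerA mulrC -scalerA.
by rewrite scaler_int; apply: VmxMq.
Qed.

(** The matrix unit (i, k), available up to the factor n, moves row k to row i. *)
Lemma Vrow_row a k : Vmx a -> Vrow (row k a).
Proof. by move=> Va i; rewrite rowE mulmxA mul_delta_mx; apply: Vmx_delta. Qed.

(** If [y] pairs integrally with [Vrow], it does so with all rows of [Vmx], so [V] kills its class;
    by [V_ann] D y is integral, and D f pairs integrally with [y]. Biduality concludes. *)
Lemma VrowMn (f : 'rV[int]_r) : Vrow (f *+ D).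
Proof.
apply: (finite_index_dual q_gt0) => [g g' Lg Lg' i|g|y yL].
- by rewrite mulmxDr mulrnDl; apply: VmxD.
- exact: VrowMq.
have yq : xi y *+ q = 0.
  apply/xiMn0 => j; have := yL _ (VrowMq (delta_mx 0 j)).
  rewrite -scaler_int map_mxZ /= map_delta_mx -scalemxAl -rowE !mxE.
  by rewrite intz mulr_natl.
have /xiMn0 yD : xi y *+ D = 0.
  apply: V_ann => v Vv; have [a aE] := hom_mxhom v q_gt0.
  rewrite aE // /mxhom; suff -> : map_mx qz (ratm a *m y) = 0 by rewrite raddf0.
  apply/qz_mx_eq0 => k.
  have -> : (ratm a *m y) k 0 = (ratm (row k a) *m y) 0 0.
    by rewrite map_row -row_mul [RHS]mxE.
  by apply/yL/Vrow_row; exists v.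
rewrite -scaler_nat map_mxZ /= -scalemxAl scalemxAr rmorph_nat.
by apply: int_ratm_mul => j; rewrite mxE mulr_natl.
Qed.

Lemma VmxMn a : Vmx (a *+ (D * n)).
Proof.
have -> : a = \sum_i delta_mx i 0 *m row i a.
  apply/matrixP => i j; rewrite summxE (bigD1 i) //= big1 ?addr0 => [|k ki].
    by rewrite mxE big_ord1 !mxE !eqxx mul1r.
  by rewrite mxE big_ord1 !mxE eq_sym (negPf ki) mul0r.
rewrite -sumrMnl; elim/big_ind: _ => [||i _]; first exact: Vmx0.
  exact: VmxD.
have := VrowMn (row i a) i.
by rewrite -[_ *+ D]scaler_nat -scalemxAr scaler_nat mulrnA.
Qed.

End Level.

(** A matrix of [h] on X[q D n] kills the classes of e_j / (D n), so it is D n times an integer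
    matrix and [VmxMn] applies. The level q D n, rather than q, makes these classes available. *)
Lemma hom_kills_mem (h : {additive X -> T}) :
  (forall x, x *+ (D * n) = 0 -> h x = 0) -> V h.
Proof.
move=> h0; apply: V_closed => q q0.
have N0 : (0 < D * n)%N by rewrite muln_gt0 D_gt0.
have qN0 : (0 < q * (D * n))%N by rewrite muln_gt0 q0.
have N0' : (D * n)%:R != 0 :> rat by rewrite pnatr_eq0 -lt0n.
have [a aE] := hom_mxhom h qN0.
have /choice[b bE] : forall ij : 'I_s * 'I_r, exists b : int,
    a ij.1 ij.2 = b *+ (D * n).
  case=> i j /=; pose y : 'cV[rat]_r := (D * n)%:R^-1 *: delta_mx j 0.
  have yN : xi y *+ (D * n) = 0.
    apply/xiMn0 => k; rewrite -[X in X \is a _]mulr_natr !mxE mulrAC mulVf // mul1r.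
    by case: (_ && _).
  have := aE y; rewrite h0 // mulnC mulrnA yN mul0rn => /(_ erefl)/esym.
  rewrite /mxhom -(raddf0 psi) => /psi_inj/qz_mx_eq0/(_ i).
  rewrite -scalemxAr -colE !mxE mulrC => /intrP[c cE].
  exists c; apply: (@intr_inj rat); rewrite -mulr_natr rmorphM /= -cE rmorph_nat.
  by rewrite mulfVK.
have aN : a = (\matrix_(i, j) b (i, j)) *+ (D * n).
  by apply/matrixP => i j; rewrite (bE (i, j)) -scaler_nat !mxE mulr_natl.
have [v Vv vE] := VmxMn qN0 (\matrix_(i, j) b (i, j)).
exists v => // x; have [y ->] := xi_surj x => yq.
have yqN : xi y *+ (q * (D * n)) = 0 by rewrite mulrnA yq mul0rn.
by rewrite aE // vE // -aN.
Qed.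

End Duality.

(** * Profinite matrices acting on torsion *)

Lemma residue_nbhs (pi : nat_pred) (x : zpi pi) k :
  nbhs x [set x' | residue x' k = residue x k].
Proof.
have c1 : continuous (@residue pi : _ -> {ptws nat -> nat}) :=
  @initial_continuous (zpi pi) {ptws nat -> nat} (@residue pi).
have c2 : continuous
    (@mathcomp_extra.proj nat (fun=> nat) k : {ptws nat -> nat} -> nat) :=
  @proj_continuous nat (fun=> nat) k.
exact: c1 x _ (c2 _ _ (discrete_set1 (residue x k))).
Qed.

Lemma residue_mx_nbhs (pi : nat_pred) m n (M : 'M[zpi pi]_(m, n)) k :
  nbhs M [set M' | forall i j, residue (M' i j) k = residue (M i j) k].
Proof.
exists (fun i j => [set x | residue x k = residue (M i j) k]) => // i j.
exact: residue_nbhs.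
Qed.

Lemma qz_natmul_mod (a b n : nat) (y : rat) : a = b %[mod n] ->
  y *+ n \is a Num.int -> qz (a%:R * y) = qz (b%:R * y).
Proof.
wlog ab : a b / (a <= b)%N => [wl e yn|].
  by case: (leqP a b) => [/wl|/ltnW/wl]; [apply|move=> ->].
move=> /eqP; rewrite eq_sym eqn_mod_dvd // => /dvdnP[k kE] yn.
apply/esym/qz_eq; rewrite -mulrBl -natrB // kE natrM -mulrA.
by rewrite rpredM ?natr_int // mulr_natl.
Qed.

Section Residues.
Variables (pi : nat_pred) (n : nat) (y : rat).
Hypotheses (pin : pi.-nat n) (yn : y *+ n \is a Num.int).
Implicit Types x : zpi pi.

Lemma qz_residueD x x' : qz ((residue (x + x') n)%:R * y) =
  qz ((residue x n)%:R * y) + qz ((residue x' n)%:R * y).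
Proof.
rewrite -raddfD -mulrDl -natrD; apply: (@qz_natmul_mod _ _ n) => //.
by rewrite /= /trunc pin modn_mod.
Qed.

Lemma qz_residueM x x' : qz ((residue (x * x') n)%:R * y) =
  qz ((residue x n)%:R * ((residue x' n)%:R * y)).
Proof.
rewrite mulrA -natrM; apply: (@qz_natmul_mod _ _ n) => //.
by rewrite /= /trunc pin modn_mod.
Qed.

Lemma qz_residue1 : qz ((residue (1 : zpi pi) n)%:R * y) = qz y.
Proof.
rewrite -[in RHS](mul1r y) -[1]/(1%:R); apply: (@qz_natmul_mod _ _ n) => //.
by rewrite /= /trunc pin modn_mod.
Qed.

Lemma qz_residue0 : qz ((residue (0 : zpi pi) n)%:R * y) = 0.
Proof. by rewrite /= /trunc pin mod0n mul0r raddf0. Qed.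

Lemma qz_residue_sum (I : finType) (F : I -> zpi pi) :
  qz ((residue (\sum_i F i) n)%:R * y) = \sum_i qz ((residue (F i) n)%:R * y).
Proof.
apply: (big_morph (fun x => qz ((residue x n)%:R * y))).
  exact: qz_residueD.
exact: qz_residue0.
Qed.

Lemma qz_residue_natr k x : qz ((residue (k%:R * x) n)%:R * y) =
  qz ((residue x n)%:R * y) *+ k.
Proof.
elim: k => [|k IH]; first by rewrite mul0r qz_residue0.
by rewrite !mulrS mulrDl mul1r qz_residueD IH.
Qed.

End Residues.

Lemma rat_mul_denq (y : rat) : y *+ `|denq y|%N \is a Num.int.
Proof.
rewrite -mulr_natr; have -> : (`|denq y|%N)%:R = (denq y)%:~R :> rat.
  by rewrite pmulrn absz_denq.
by rewrite -[X in X * _]divq_num_den mulfVK ?intr_eq0 ?denq_eq0 // intr_int.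
Qed.

Lemma denq_dvdn (y : rat) n : y *+ n \is a Num.int -> (`|denq y| %| n)%N.
Proof.
move=> /intrP[c cE]; have : numq y * n%:Z = c * denq y.
  apply: (@intr_inj rat); rewrite !rmorphM /= -cE numqE mulrAC.
  by rewrite -[n%:~R]/(n%:R) mulr_natr.
move=> /(congr1 absz); rewrite !abszM => e.
have := dvdn_mull `|c| (dvdnn `|denq y|); rewrite -e Gauss_dvdr //.
by rewrite coprime_sym coprime_num_den.
Qed.

Lemma predT_pnat n : (0 < n)%N -> (predT : nat_pred).-nat n.
Proof. by move=> n0; rewrite /pnat n0; apply/allP. Qed.

(** Frees [zhat_act] from the chosen representative and its exact denominator: a common multiple of
    denominators can serve for a whole vector. *)
Lemma zhat_actE (x : Zhat) (y : rat) n : (0 < n)%N -> y *+ n \is a Num.int ->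
  zhat_act x (qz y) = qz ((residue x n)%:R * y).
Proof.
move=> n0 yn; rewrite /zhat_act; set y' := repr (qz y).
have yy' : y - y' \is a Num.int by apply/qz_eq; rewrite /y' /qz reprK.
have y'n : y' *+ n \is a Num.int.
  have -> : y' = y - (y - y') by rewrite opprB addrC subrK.
  by rewrite mulrnBl rpredB // rpredMn.
have dn := denq_dvdn y'n.
rewrite (@qz_natmul_mod _ (residue x n) `|denq y'|%N) ?rat_mul_denq //; last first.
  by rewrite -(residue_eqmod x (predT_pnat n0) dn).
by apply/esym/qz_eq; rewrite -mulrBr rpredM // natr_int.
Qed.

(** * Endomorphisms of [T] that preserve [V], and their gluing by the Chinese remainder theorem *)

Section Stabilizer.
Variables (s : nat) (X T : zmodType).
Variable psi : {additive 'cV[QZ]_s -> T}.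
Variable V : set {additive X -> T}.
Hypothesis V0 : forall h : {additive X -> T}, (forall x, h x = 0) -> V h.
Hypothesis VD : forall h1 h2 h : {additive X -> T},
  (forall x, h x = h1 x + h2 x) -> V h1 -> V h2 -> V h.
Implicit Types (beta : T -> T) (u : 'cV[rat]_s).

Record stabilizes beta : Prop := Stabilizes {
  stabB : zmod_morphism beta;
  stabV : forall v, V v -> exists2 w, V w & forall x, w x = beta (v x) }.

Lemma stab_id : stabilizes id.
Proof. by split=> // v Vv; exists v. Qed.

Lemma stab_zero : stabilizes (fun=> 0).
Proof.
split=> [x y|v Vv]; first by rewrite subrr.
by exists (\0 : {additive X -> T}) => //; apply: V0.
Qed.

Lemma stabD beta beta' : stabilizes beta -> stabilizes beta' ->
  stabilizes (fun t => beta t + beta' t).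
Proof.
move=> [bB bV] [bB' bV']; split=> [x y|v Vv].
  by rewrite bB bB' addrACA -opprD.
have [[w Vw wE] [w' Vw' wE']] := (bV v Vv, bV' v Vv).
exists (w \+ w' : {additive X -> T}); first exact: VD Vw Vw'.
by move=> x; rewrite /= wE wE'.
Qed.

Lemma stabMn beta k : stabilizes beta -> stabilizes (fun t => beta t *+ k).
Proof.
move=> bS; elim: k => [|k IH].
  by have -> : (fun t => beta t *+ 0) = (fun=> 0) by []; apply: stab_zero.
have -> : (fun t => beta t *+ k.+1) = (fun t => beta t + beta t *+ k).
  by apply/funext => t; rewrite mulrS.
exact: stabD.
Qed.

Lemma stab_comp beta beta' : stabilizes beta -> stabilizes beta' ->
  stabilizes (beta \o beta').
Proof.
move=> [bB bV] [bB' bV']; split=> [x y|v Vv]; first by rewrite /= bB' bB.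
have [w Vw wE] := bV' v Vv; have [w' Vw' wE'] := bV w Vw.
by exists w' => // x; rewrite wE' wE.
Qed.

Lemma stab0 beta : stabilizes beta -> beta 0 = 0.
Proof. by move=> [bB _]; have := bB 0 0; rewrite !subrr. Qed.

Lemma stab_natmul beta t k : stabilizes beta -> beta (t *+ k) = beta t *+ k.
Proof.
move=> bS; have bD x y : beta (x + y) = beta x + beta y.
  by apply: (addIr (- beta y)); rewrite -(stabB bS) !addrK.
by elim: k => [|k IH]; rewrite ?mulr0n ?stab0 // !mulrS bD IH.
Qed.

Section Matrices.
Variables (pi : nat_pred) (q : nat).
Hypothesis piq : pi.-nat q.
Implicit Types M : 'M[zpi pi]_s.

Definition resmx M : 'M[rat]_s := map_mx (fun x => (residue x q)%:R) M.

(** Only the q-torsion is tested, so that an ell-adic matrix can be compared with an endomorphism of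
    the whole of [T]. *)
Definition acts_as M beta := forall u, (forall k, u k 0 *+ q \is a Num.int) ->
  beta (psi (map_mx qz u)) = psi (map_mx qz (resmx M *m u)).

Lemma resmx_int M u : (forall k, u k 0 *+ q \is a Num.int) ->
  forall k, (resmx M *m u) k 0 *+ q \is a Num.int.
Proof.
move=> uq k; rewrite mxE -sumrMnl rpred_sum // => j _.
by rewrite -mulrnAr rpredM // mxE natr_int.
Qed.

Lemma qz_resmx M u i : map_mx qz (resmx M *m u) i 0 =
  \sum_j qz ((residue (M i j) q)%:R * u j 0).
Proof. by rewrite !mxE raddf_sum; apply: eq_bigr => j _; rewrite !mxE. Qed.

Lemma acts_as1 : acts_as 1%:M id.
Proof.
move=> u uq; congr (psi _); apply/colP => i; rewrite qz_resmx (bigD1 i) //= big1.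
  by rewrite addr0 !mxE eqxx qz_residue1.
by move=> j ji; rewrite !mxE eq_sym (negPf ji) qz_residue0.
Qed.

Lemma acts_asD M M' beta beta' : acts_as M beta -> acts_as M' beta' ->
  acts_as (M + M') (fun t => beta t + beta' t).
Proof.
move=> bM bM' u uq; rewrite bM // bM' // -raddfD; congr (psi _).
apply/colP => i; rewrite mxE !qz_resmx -big_split; apply: eq_bigr => j _.
by rewrite mxE /= qz_residueD.
Qed.

Lemma acts_asM M M' beta beta' : acts_as M beta -> acts_as M' beta' ->
  acts_as (M *m M') (beta \o beta').
Proof.
move=> bM bM' u uq /=; rewrite bM' // bM; last exact: resmx_int.
congr (psi _); apply/colP => i; rewrite !qz_resmx.
transitivity (\sum_j \sum_k
  qz ((residue (M i k) q)%:R * ((residue (M' k j) q)%:R * u j 0))).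
  rewrite exchange_big; apply: eq_bigr => k _; rewrite -raddf_sum mxE mulr_sumr.
  by congr qz; apply: eq_bigr => j _; rewrite mxE.
apply: eq_bigr => j _; rewrite mxE qz_residue_sum //; apply: eq_bigr => k _.
by rewrite qz_residueM.
Qed.

Lemma acts_asZ (a : zpi pi) M beta : acts_as M beta ->
  acts_as (a *: M) (fun t => beta t *+ residue a q).
Proof.
move=> bM u uq; rewrite bM // -raddfMn; congr (psi _).
apply/colP => i; rewrite mulmxnE !qz_resmx -sumrMnl; apply: eq_bigr => j _.
by rewrite mxE qz_residueM // -raddfMn; congr qz; rewrite [RHS]mulr_natl.
Qed.

End Matrices.

(** The matrices acting on the q-torsion like some stabilizing endomorphism form a subalgebra,
    closed because membership depends only on residues modulo q; an ell-adic scalar acts there as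
    its natural residue. *)
Lemma closed_alg_gen_acts (ell q : nat) (H : set 'M[zpi ell]_s) :
  (ell : nat_pred).-nat q ->
  (forall M, H M -> exists2 beta, stabilizes beta & acts_as q M beta) ->
  forall M, closed_alg_gen H M -> exists2 beta, stabilizes beta & acts_as q M beta.
Proof.
move=> ellq HS M.
move=> /(_ [set M' | exists2 beta, stabilizes beta & acts_as q M' beta]); apply=> //.
- move=> M1 /(_ _ (residue_mx_nbhs M1 q))[M2 [[beta bS bM2] /= M12]].
  exists beta => //; rewrite /acts_as; suff -> : resmx q M1 = resmx q M2 by [].
  by apply/matrixP => i j; rewrite !mxE M12.
- by exists id; [apply: stab_id|apply: acts_as1].
- move=> B C [b bS bB] [c cS cC]; exists (fun t => b t + c t); first exact: stabD.
  exact: acts_asD.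
- move=> B C [b bS bB] [c cS cC]; exists (b \o c); first exact: stab_comp.
  exact: acts_asM.
- move=> a B [b bS bB]; exists (fun t => b t *+ residue a q); first exact: stabMn.
  exact: acts_asZ.
Qed.

Section Assembly.
Variable n : nat.
Variable H : forall ell : nat, set 'M[zpi ell]_s.
Hypothesis H_acts : forall ell e, prime ell -> forall M, @H ell M ->
  exists2 beta, stabilizes beta & acts_as (ell ^ e) M beta.
Hypothesis n_alg : forall ell, prime ell -> forall M : 'M[zpi ell]_s,
  closed_alg_gen (@H ell) ((ell ^ logn ell n)%:R *: M).

Lemma delta_stab q (i j : 'I_s) : (0 < q)%N ->
  exists2 beta, stabilizes beta & forall u, (forall k, u k 0 *+ q \is a Num.int) ->
    beta (psi (map_mx qz u)) = psi (map_mx qz (delta_mx i j *m u)) *+ n.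
Proof.
pose good q beta := forall u, (forall k, u k 0 *+ q \is a Num.int) ->
    beta (psi (map_mx qz u)) = psi (map_mx qz (delta_mx i j *m u)) *+ n.
have prime_power ell e : prime ell ->
    exists2 beta, stabilizes beta & good (ell ^ e)%N beta.
  move=> ell_pr; have ellq : (ell : nat_pred).-nat (ell ^ e)%N by rewrite pnatX pnat_id.
  have [beta bS bM] := closed_alg_gen_acts ellq (H_acts e ell_pr)
    (n_alg ell_pr (delta_mx i j)).
  (* The assumption only supplies the ell-part of n; the cofactor makes the multiplier equal to n at
     every prime. *)
  exists (fun t => beta t *+ (n %/ ell ^ logn ell n)); first exact: stabMn.
  move=> u uq; rewrite bM // -raddfMn -[RHS]raddfMn; congr (psi _).
  rewrite -[in RHS](divnK (pfactor_dvdnn ell n)) mulnC mulrnA; congr (_ *+ _).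
  apply/colP => k; rewrite mulmxnE qz_resmx.
  have -> : map_mx qz (delta_mx i j *m u) k 0 = (if k == i then qz (u j 0) else 0).
    rewrite !mxE (bigD1 j) //= big1 ?addr0 => [|l lj].
      by rewrite !mxE eqxx andbT; case: eqP => _; rewrite ?mul1r ?mul0r ?raddf0.
    by rewrite !mxE (negPf lj) andbF mul0r.
  rewrite (bigD1 j) //= big1 ?addr0 => [|l lj].
    rewrite !mxE qz_residue_natr // eqxx andbT; congr (_ *+ _).
    by case: eqP => _; rewrite ?qz_residue1 ?qz_residue0.
  by rewrite !mxE qz_residue_natr // (negPf lj) andbF qz_residue0 // mul0rn.
have coprime_mul a b : (0 < a)%N -> (0 < b)%N -> coprime a b ->
    (exists2 beta, stabilizes beta & good a beta) ->
    (exists2 beta, stabilizes beta & good b beta) ->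
    exists2 beta, stabilizes beta & good (a * b)%N beta.
  move=> a0 b0 ab [ba baS baG] [bb bbS bbG].
  (* c is 1 modulo a and 0 modulo b, and d conversely: multiplying ab-torsion by c lands in the
     a-torsion, where [ba] is known, and c + d is 1 modulo ab. *)
  pose c := chinese a b 1 0; pose d := chinese a b 0 1.
  exists (fun t => ba t *+ c + bb t *+ d); first by apply: stabD; apply: stabMn.
  move=> u uq.
  have split_ k x (bk : T -> T) (bS : stabilizes bk) : good k bk ->
      (forall l, u l 0 *+ x *+ k \is a Num.int) ->
      bk (psi (map_mx qz u)) *+ x = psi (map_mx qz (delta_mx i j *m u)) *+ n *+ x.
    move=> bG uk; rewrite -stab_natmul // -!raddfMn bG => [|l]; last first.
      by rewrite mulmxnE.
    rewrite -scaler_nat -scalemxAr scaler_nat !raddfMn.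
    by rewrite -!mulrnA mulnC.
  rewrite (split_ a c) // => [|l]; last first.
    have /dvdnP[k ->] : (b %| c)%N by rewrite /dvdn (chinese_modr ab) mod0n.
    by rewrite -mulrnA -mulnA [(b * a)%N]mulnC mulnC mulrnA rpredMn.
  rewrite (split_ b d) // => [|l]; last first.
    have /dvdnP[k ->] : (a %| d)%N by rewrite /dvdn (chinese_modl ab) mod0n.
    by rewrite -mulrnA -mulnA mulnC mulrnA rpredMn.
  rewrite -mulrnDr.
  have wq : map_mx qz (delta_mx i j *m u) *+ (a * b) = 0.
    rewrite -raddfMn; apply/qz_mx_eq0 => k.
    rewrite mulmxnE mxE -sumrMnl rpred_sum // => l _.
    by rewrite -mulrnAr rpredM // mxE; case: (_ && _).
  set t := psi _ *+ n; have tq : t *+ (a * b) = 0.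
    by rewrite /t mulrnAC -(raddfMn psi (a * b)%N) wq raddf0 mul0rn.
  have cd : (c + d = 1 %[mod a * b])%N.
    apply/eqP; rewrite chinese_remainder //; apply/andP; split; apply/eqP.
      by rewrite -modnDm (chinese_modl ab) (chinese_modl ab) mod0n addn0 modn_mod.
    by rewrite -modnDm (chinese_modr ab) (chinese_modr ab) mod0n add0n modn_mod.
  rewrite (divn_eq (c + d) (a * b)) cd mulrnDr mulnC mulrnA tq mul0rn add0r.
  rewrite -[RHS]mulr1n [in RHS](divn_eq 1 (a * b)) mulrnDr [(_ %/ _ * _)%N]mulnC.
  by rewrite [in RHS]mulrnA tq mul0rn add0r.
have [k] := ubnP q; elim: k q => // k IH q /ltnSE qk q0.
have [q1|q1] := leqP q 1.
  (* The trivial level is taken as a prime power with exponent 0. *)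
  have -> : q = (2 ^ 0)%N by apply/eqP; rewrite eqn_leq q1.
  exact: prime_power.
have ell_pr := pdiv_prime q1; set ell := pdiv q in ell_pr.
have [q' cop qE] := pfactor_coprime ell_pr q0.
have q'0 : (0 < q')%N by move: q0; rewrite qE muln_gt0 => /andP[].
have e0 : (0 < logn ell q)%N by rewrite logn_gt0 mem_primes ell_pr q0 pdiv_dvd.
rewrite qE; apply: coprime_mul => //.
- by rewrite coprime_sym coprimeXl.
- apply: IH => //; apply: leq_trans qk; rewrite qE -[X in (X < _)%N]muln1.
  by rewrite ltn_pmul2l // -[1%N](expn0 ell) ltn_exp2l ?prime_gt1.
- exact: prime_power.
Qed.

End Assembly.
End Stabilizer.

(** * Counting cosets *)

Lemma card_set_finset (T : finType) (D : {set T}) : [set` D] #= `I_#|D|.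
Proof.
have [x0 x0D|D0] := pickP (mem D); last first.
  have -> : D = finset.set0 by apply/setP => x; rewrite inE; apply: D0.
  rewrite cards0 II0.
  have -> : [set` (finset.set0 : {set T})] = set0.
    by apply/seteqP; split=> x //=; rewrite inE.
  exact: card_eq00.
have -> : [set` D] = (fun i => nth x0 (enum D) i) @` `I_#|D|.
  apply/seteqP; split=> [x /= xD|_ [i iD <-] /=].
    exists (index x (enum D)); last by rewrite nth_index // mem_enum.
    by rewrite /= cardE index_mem mem_enum.
  by rewrite -mem_enum mem_nth // -cardE.
apply: inj_card_eq => i j; rewrite !inE /= => iD jD /eqP.
by rewrite nth_uniq -?cardE ?enum_uniq // => /eqP.
Qed.

Section Cosets.
Variables (X T : zmodType) (V : set {additive X -> T}).
Hypothesis V0 : forall h : {additive X -> T}, (forall x, h x = 0) -> V h.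
Hypothesis VD : forall h1 h2 h : {additive X -> T},
  (forall x, h x = h1 x + h2 x) -> V h1 -> V h2 -> V h.
Hypothesis VN : forall h h' : {additive X -> T},
  (forall x, h' x = - h x) -> V h -> V h'.
Variables (gT : finGroupType) (ev : {additive X -> T} -> gT).
Hypothesis evD : forall h h1 h2 : {additive X -> T},
  (forall x, h x = h1 x + h2 x) -> ev h = (ev h2 * ev h1)%g.
Hypothesis ev_inj : forall h h' : {additive X -> T}, ev h = ev h' ->
  exists2 v, V v & forall x, h x = h' x + v x.

Let coset (h : {additive X -> T}) := [set h' : {additive X -> T} |
  exists2 v : {additive X -> T}, V v & forall x, h' x = h x + v x].

(** [ev] turns the coset of [h] into the right coset C ev h, with B and C the images of all
    homomorphisms and of [V]; by [ev_inj] no two cosets are merged. Their number is thus the index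
    of C in B, a divisor of the order of the group. *)
Lemma card_cosets : exists2 k, [set coset h | h in [set: {additive X -> T}]] #= `I_k &
  (k %| #|gT|)%N.
Proof.
pose B := [set a : gT | `[< exists h, a = ev h >]]%SET.
pose C := [set a : gT | `[< exists2 h, V h & a = ev h >]]%SET.
have ev0 : ev (\0 : {additive X -> T}) = 1%g.
  have := @evD \0 \0 \0 (fun x => esym (addr0 _)).
  by move/(congr1 (fun a => (a * (ev \0)^-1)%g)); rewrite mulgV mulgK.
have BP a : reflect (exists h, a = ev h) (a \in B).
  by rewrite finset.in_set; apply: asboolP.
have CP a : reflect (exists2 h, V h & a = ev h) (a \in C).
  by rewrite finset.in_set; apply: asboolP.
have gB : group_set B.
  apply/group_setP; split=> [|a b]; first by apply/BP; exists \0.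
  move=> /BP[h ->] /BP[h' ->]; apply/BP.
  by exists (h' \+ h : {additive X -> T}); apply/esym/evD.
have gC : group_set C.
  apply/group_setP; split=> [|a b].
    by apply/CP; exists \0 => //; apply: V0.
  move=> /CP[h Vh ->] /CP[h' Vh' ->]; apply/CP.
  exists (h' \+ h : {additive X -> T}); last exact/esym/evD.
  exact: VD Vh' Vh.
pose F (E : set {additive X -> T}) := [set a : gT | `[< exists2 h, E h & a = ev h >]]%SET.
have FE h : F (coset h) = (C :* ev h)%g.
  apply/setP => a; rewrite finset.in_set; apply/asboolP/rcosetP => [[h' [v Vv h'E] ->]|].
    by exists (ev v); [apply/CP; exists v|apply: evD].
  move=> [_ /CP[v Vv ->] ->].
  exists (h \+ v : {additive X -> T}); last exact/esym/evD.
  by exists v.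
have Finj : {in [set coset h | h in [set: {additive X -> T}]] &, injective F}.
  move=> _ _ /[!inE] -[h _ <-] [h' _ <-]; rewrite !FE => FEE.
  have : ev h \in (C :* ev h')%g by rewrite -FEE; apply: (rcoset_refl (group gC)).
  move=> /rcosetP[_ /CP[v Vv ->]].
  rewrite -(@evD (h' \+ v : {additive X -> T})) // => /ev_inj[w Vw hE].
  have Vvw : V (v \+ w : {additive X -> T}) by apply: VD Vv Vw.
  have VNvw : V (\- (v \+ w) : {additive X -> T}) by apply: VN Vvw.
  apply/seteqP; split=> g [u Vu gE].
    exists ((v \+ w) \+ u : {additive X -> T}); first exact: VD Vvw Vu.
    by move=> x; rewrite gE hE /= -!addrA.
  exists ((\- (v \+ w)) \+ u : {additive X -> T}); first exact: VD VNvw Vu.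
  by move=> x; rewrite gE hE /= [RHS]addrA -[h' x + v x + w x]addrA addrK.
have FEnt : F @` [set coset h | h in [set: {additive X -> T}]] = [set` rcosets C B].
  apply/seteqP; split=> [_ [_ [h _ <-] <-] /=|A /= /rcosetsP[_ /BP[h ->] ->]].
    by apply/rcosetsP; exists (ev h); rewrite ?FE //; apply/BP; exists h.
  by exists (coset h); rewrite ?FE //; exists h.
exists #|rcosets C B|.
  apply: card_eq_trans (card_set_finset _); rewrite -FEnt.
  exact/card_esym/inj_card_eq.
apply: dvdn_trans (dvdn_indexg (group gB) (group gC)) _.
by have := @cardSg gT [set: gT]%G (group gB) (finset.subsetT _); rewrite cardsT.
Qed.

End Cosets.

(** The group Z/N is taken as ['I_N], which is trivial for N = 1, whereas ['Z_1] has two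
    elements. *)
Lemma Zp_intmul_eq0 k (d : int) :
  ((inZp 1 : 'I_k.+1) *~ d == 0) = (k.+1 %| d)%Z.
Proof.
have nat_case j : ((inZp 1 : 'I_k.+1) *+ j == 0) = (k.+1 %| j)%N.
  rewrite Zp_mulrn -val_eqE /= modnMml mul1n //.
case: d => j; first by rewrite -pmulrn nat_case.
by rewrite NegzE mulrNz oppr_eq0 -pmulrn nat_case dvdzE abszN.
Qed.

(** * Index of a subgroup containing the homomorphisms that kill X[N] *)

Section CosetsDuality.
Variables (r s : nat) (X T : zmodType).
Variables (xi : {additive 'cV[rat]_r -> X}) (psi : {additive 'cV[QZ]_s -> T}).
Hypothesis xi_surj : forall x, exists y, x = xi y.
Hypothesis xi_ker : forall y, (xi y = 0) <-> (forall j, y j 0 \is a Num.int).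
Hypothesis psi_bij : bijective psi.
Variable V : set {additive X -> T}.
Hypothesis V0 : forall h : {additive X -> T}, (forall x, h x = 0) -> V h.
Hypothesis VD : forall h1 h2 h : {additive X -> T},
  (forall x, h x = h1 x + h2 x) -> V h1 -> V h2 -> V h.
Variable N' : nat.
Local Notation N := N'.+1.
Hypothesis V_kills : forall h : {additive X -> T},
  (forall x, x *+ N = 0 -> h x = 0) -> V h.

(** -h is (N - 1) h plus -N h, and the latter kills X[N]. *)
Lemma kills_opp (h h' : {additive X -> T}) : (forall x, h' x = - h x) -> V h -> V h'.
Proof.
move=> h'E Vh.
have [g [gE Vg]] : exists g : {additive X -> T}, (forall x, g x = h x *+ N') /\ V g.
  elim: N' => [|k [g [gE Vg]]].
    by exists (\0 : {additive X -> T}); split=> //; apply: V0.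
  exists (h \+ g : {additive X -> T}); split; last exact: VD Vh Vg.
  by move=> x /=; rewrite gE mulrS.
have Vk : V (h' \- g : {additive X -> T}).
  apply: V_kills => x xN /=; rewrite h'E gE -opprD -mulrS -raddfMn xN raddf0.
  by rewrite oppr0.
by apply: VD Vg Vk => x /=; rewrite addrC subrK.
Qed.

Lemma mxhom_congr (a b : 'M[int]_(s, r)) :
  (forall i j, (N %| a i j - b i j)%Z) <->
  (forall y, xi y *+ N = 0 -> mxhom psi a y = mxhom psi b y).
Proof.
have N0 : N%:R != 0 :> rat by rewrite pnatr_eq0.
split=> [ab y /(xiMn0 xi_ker) yN|ab i j].
  have /choice[c cE] : forall ij : 'I_s * 'I_r, exists c : int,
      a ij.1 ij.2 - b ij.1 ij.2 = c * N%:Z.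
    by case=> i j; apply/dvdzP/ab.
  have -> : a = b + (\matrix_(i, j) c (i, j)) *~ N%:Z.
    apply/matrixP => i j; rewrite -scaler_int !mxE intz mulrC -(cE (i, j)) /=.
    by rewrite addrC subrK.
  rewrite mxhomD mxhomMz [X in _ + X]mxhom_int ?addr0 // => j.
  by rewrite mulmxnE.
pose y : 'cV[rat]_r := N%:R^-1 *: delta_mx j 0.
have yN : xi y *+ N = 0.
  apply/(xiMn0 xi_ker) => k.
  rewrite -[X in X \is a _]mulr_natr !mxE mulrAC mulVf // mul1r.
  by case: (_ && _).
have yE c : map_mx qz (map_mx intr c *m y) i 0 = qz ((c i j)%:~R / N%:R).
  by rewrite /y -scalemxAr -colE !mxE mulrC.
have /(bij_inj psi_bij)/matrixP/(_ i 0) := ab y yN.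
rewrite !yE => /qz_eq; rewrite -mulrBl -rmorphB /= => /intrP[c cE].
apply/dvdzP; exists c; apply: (@intr_inj rat); rewrite rmorphM /= -cE.
by rewrite -[X in _ * X]/(N%:R) mulfVK.
Qed.

Lemma card_cosets_kills : exists2 k,
  [set [set h' : {additive X -> T} |
    exists2 v : {additive X -> T}, V v & forall x, h' x = h x + v x]
  | h in [set: {additive X -> T}]] #= `I_k & (k %| N ^ (r * s))%N.
Proof.
have N0 : (0 < N)%N by [].
have /choice[mx mxP] : forall h : {additive X -> T}, exists a, forall y,
    xi y *+ N = 0 -> h (xi y) = mxhom psi a y.
  by move=> h; apply: (hom_mxhom xi_ker psi_bij h N0).
pose ev h : 'M['I_N]_(s, r) := map_mx (fun c : int => (inZp 1 : 'I_N) *~ c) (mx h).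
have ev_eq (a b : 'M[int]_(s, r)) :
    (map_mx (fun c : int => (inZp 1 : 'I_N) *~ c) a =
     map_mx (fun c : int => (inZp 1 : 'I_N) *~ c) b) <->
    (forall i j, (N %| a i j - b i j)%Z).
  split=> [/matrixP ab i j|ab].
    rewrite -Zp_intmul_eq0 mulrzBr; have := ab i j; rewrite !mxE => ->.
    by rewrite subrr.
  apply/matrixP => i j; rewrite !mxE; apply/eqP; rewrite -subr_eq0 -mulrzBr.
  by rewrite Zp_intmul_eq0.
rewrite mulnC -[N in (N ^ _)%N]card_ord -card_mx.
apply: (@card_cosets _ _ _ V0 VD kills_opp _ ev).
- move=> h h1 h2 hE; rewrite FinRing.zmodMgE /ev.
  have -> : forall a b : 'M[int]_(s, r),
    map_mx (fun c : int => (inZp 1 : 'I_N) *~ c) a +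
    map_mx (fun c : int => (inZp 1 : 'I_N) *~ c) b =
    map_mx (fun c : int => (inZp 1 : 'I_N) *~ c) (a + b).
    by move=> a b; apply/matrixP => i j; rewrite !mxE mulrzDr.
  apply/ev_eq/mxhom_congr => y yN; rewrite mxhomD -!mxP // hE.
  by rewrite addrC.
- move=> h h' /ev_eq/mxhom_congr hh'.
  exists (h \- h' : {additive X -> T}); last by move=> x /=; rewrite addrC subrK.
  apply: V_kills => x; have [y ->] := xi_surj x => yN /=.
  by rewrite !mxP // hh' // subrr.
Qed.

End CosetsDuality.

(** * Coordinates given by Phi *)

Lemma zhat_actB (x : Zhat) : zmod_morphism (zhat_act x).
Proof.
move=> u v; have [y ->] := qz_surj u; have [z ->] := qz_surj v.
pose k := (`|denq y| * `|denq z|)%N.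
have k0 : (0 < k)%N by rewrite muln_gt0 !absz_gt0 !denq_eq0.
have yk : y *+ k \is a Num.int by rewrite mulrnA rpredMn ?rat_mul_denq.
have zk : z *+ k \is a Num.int by rewrite /k mulnC mulrnA rpredMn ?rat_mul_denq.
rewrite -raddfB !(@zhat_actE _ _ k) ?mulrnBl ?rpredB //.
by rewrite mulrBr raddfB.
Qed.

Lemma zhat_mxactB s r (M : 'M[Zhat]_(s, r)) : zmod_morphism (zhat_mxact M).
Proof.
move=> u v; apply/colP => i; rewrite !mxE -sumrB; apply: eq_bigr => j _.
by rewrite !mxE zhat_actB.
Qed.

Lemma zhat_mxactE s r (M : 'M[Zhat]_(s, r)) (y : 'cV[rat]_r) k i : (0 < k)%N ->
  (forall j, y j 0 *+ k \is a Num.int) -> zhat_mxact M (map_mx qz y) i 0 =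
  \sum_j qz ((residue (M i j) k)%:R * y j 0).
Proof.
move=> k0 yk; rewrite mxE; apply: eq_bigr => j _.
by rewrite mxE (zhat_actE _ k0).
Qed.

Lemma rat_col_denominator k (x : 'cV[rat]_k) :
  exists2 N, (0 < N)%N & forall i, x i 0 *+ N \is a Num.int.
Proof.
exists (\prod_i `|denq (x i 0%R)|)%N => [|i].
  by apply: prodn_gt0 => i; rewrite absz_gt0 denq_eq0.
by rewrite (bigD1 i) //= mulrnA rpredMn ?rat_mul_denq.
Qed.

Section Coordinates.
Variables (K L : fieldType) (iota : {rmorphism K -> L}) (G : cAlgGroup iota).
Variables (A : zmodClosed (gpt G)) (r s : nat).
Variable Phi : {additive gam A -> 'cV[rat]_r * 'cV[QZ]_s}.
Hypotheses (Phi_bij : bijective Phi) (Phi_A : maps_onto_Zr Phi).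

(** Q^r is torsion-free, and every element of (Q/Z)^s is torsion. *)
Lemma Phi_torsion (b : gam A) : (gam_val b \in torsion G) <-> ((Phi b).1 = 0).
Proof.
split=> [/asboolP[k k0 bk]|b0].
  have : Phi (b *+ k) = 0.
    by have -> : b *+ k = 0; [apply/val_inj; rewrite /= gam_valMn|rewrite raddf0].
  rewrite raddfMn => /(congr1 fst); rewrite (raddfMn fst) /= => /eqP.
  by rewrite -scaler_nat scaler_eq0 pnatr_eq0 -leqn0 leqNgt k0 => /eqP.
have [x xE] := qz_mx_surj (Phi b).2; have [N N0 xN] := rat_col_denominator x.
apply/asboolP; exists N => //; rewrite -gam_valMn.
suff -> : b *+ N = 0 by [].
apply: (bij_inj Phi_bij); rewrite raddf0 raddfMn [Phi b]surjective_pairing b0 xE.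
apply/eqP; rewrite -pair_eqE /= (raddfMn fst) (raddfMn snd) /= mul0rn eqxx /=.
rewrite -raddfMn; apply/eqP/qz_mx_eq0 => i.
by rewrite mulmxnE.
Qed.

Lemma Phi_int (y : 'cV[rat]_r) : (forall j, y j 0 \is a Num.int) ->
  exists2 b : gam A, gam_val b \in A & Phi b = (y, 0).
Proof.
move=> yZ; pose z : 'cV[int]_r := map_mx Num.floor y.
have yE : y = map_mx intr z.
  by apply/colP => j; rewrite !mxE floorK.
have : (Phi @` [set b | gam_val b \in A]) (y, 0).
  by rewrite Phi_A; exists z; rewrite // yE.
by case=> b bA bE; exists b.
Qed.

Lemma Phi_A_int (b : gam A) : gam_val b \in A ->
  forall j, (Phi b).1 j 0 \is a Num.int.
Proof.
move=> bA j; have : (Phi @` [set b | gam_val b \in A]) (Phi b) by exists b.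
by rewrite Phi_A => -[z _ <-] /=; rewrite mxE intr_int.
Qed.

Lemma A_tors_int (b : gam A) : (b \in @A_tors _ _ _ _ A) <->
  (forall j, (Phi b).1 j 0 \is a Num.int).
Proof.
split=> [/asboolP[a aA bT] j|bZ].
  have aG : a \in div_hull A by apply/asboolP; exists 1%N; rewrite ?mulr1n.
  have /Phi_torsion : gam_val (b - Gam aG) \in torsion G by [].
  rewrite raddfB (raddfB fst) => /eqP; rewrite subr_eq0 => /eqP ->.
  exact: Phi_A_int.
have [c cA cE] := Phi_int bZ; apply/asboolP; exists (gam_val c) => //.
rewrite -gam_valB; apply/Phi_torsion.
by rewrite raddfB (raddfB fst) cE subrr.
Qed.

(** By [A_tors_int], A + G_tors is the part of Gamma with integral first component. [xi] starts from
    Q^r, with kernel Z^r, instead of from (Q/Z)^r, so that later computations stay with rational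
    vectors. *)
Lemma coordinates_exist :
  exists (xi : {additive 'cV[rat]_r -> gam_quot A})
         (psi : {additive 'cV[QZ]_s -> tors G}),
  [/\ forall b, gam_class b = xi (Phi b).1,
      forall y, (xi y = 0) <-> (forall j, y j 0 \is a Num.int),
      forall t, psi (Phi (gam_of_tors A t)).2 = t &
      forall w, (Phi (gam_of_tors A (psi w))).2 = w].
Proof.
have [Psi PhiK PsiK] := Phi_bij.
have PsiB : zmod_morphism Psi.
  by move=> y z; apply: (bij_inj Phi_bij); rewrite raddfB !PsiK.
pose xf y := gam_class (Psi (y, 0)).
have xfB : zmod_morphism xf.
  move=> y z; rewrite /xf -raddfB -PsiB; congr (gam_class (Psi _)).
  by apply/eqP; rewrite -pair_eqE /= subrr !eqxx.
pose xi : {additive 'cV[rat]_r -> gam_quot A} :=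
  HB.pack xf (GRing.isZmodMorphism.Build _ _ xf xfB).
have pT w : gam_val (Psi (0, w)) \in torsion G by apply/Phi_torsion; rewrite PsiK.
pose pf w : tors G := Tors (pT w).
have pfB : zmod_morphism pf.
  move=> w z; apply/val_inj; change (gam_val (Psi (0, w - z)) =
    gam_val (Psi (0, w)) - gam_val (Psi (0, z))).
  rewrite -gam_valB -PsiB; congr (gam_val (Psi _)).
  by apply/eqP; rewrite -pair_eqE /= subrr !eqxx.
pose psi : {additive 'cV[QZ]_s -> tors G} :=
  HB.pack pf (GRing.isZmodMorphism.Build _ _ pf pfB).
have pfE w : gam_of_tors A (pf w) = Psi (0, w) by apply/val_inj.
exists xi, psi; split=> [b|y|t|w] /=.
- apply/gam_class_eq/A_tors_int => j.
  by rewrite raddfB (raddfB fst) PsiK /= subrr mxE.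
- rewrite /xf; split=> [/gam_class0/A_tors_int|yZ]; first by rewrite PsiK.
  by apply/gam_class0/A_tors_int; rewrite PsiK.
- have t0 : (Phi (gam_of_tors A t)).1 = 0 by apply/Phi_torsion; case: (t).
  apply/val_inj; change (gam_val (Psi (0, (Phi (gam_of_tors A t)).2)) = tors_val t).
  by rewrite -t0 -surjective_pairing PhiK.
- by rewrite pfE PsiK.
Qed.

End Coordinates.

Section TorsionAction.
Variables (K : fieldType) (L : closedFieldType) (iota : {rmorphism K -> L}).
Hypothesis L_algebraic : integralRange iota.
Variables (G : cAlgGroup iota).

Lemma tors_actB sigma : Gal_infty G sigma -> zmod_morphism (@tors_act _ _ _ G sigma).
Proof.
move=> galS t u.
have [tau galT tauE] := gal_extend L_algebraic (K_infty_closed G) (fun x => id)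
  (@base_K_infty _ _ _ G) galS.
have actE (w : tors G) : tors_val (tors_act sigma w) = gal_act tau (tors_val w).
  rewrite tors_actE // (gal_act_eq_on tauE) //.
  by apply: torsion_K_infty; case: (w).
apply/val_inj; change (tors_val (tors_act sigma (t - u)) =
  tors_val (tors_act sigma t) - tors_val (tors_act sigma u)).
by rewrite !actE tors_valB actB.
Qed.

End TorsionAction.

Theorem theorem5p9 (K : fieldExtType rat) (L : closedFieldType)
    (iota : {rmorphism K -> L}) (L_algebraic : integralRange iota)
    (G : cAlgGroup iota) (G_connected : zariski_connected iota (cag_var G))
    (A : zmodClosed (gpt G))
    (A_rational : {subset A <= point_over (base_field iota)})
    (A_fg : finitely_generated A) (A_tf : torsion_free A)
    (r : nat) (A_rank : has_rank A r) (r_gt0 : (0 < r)%N)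
    (s : nat) (G_tors_rank : torsion_rank G s)
    (Phi : {additive gam A -> 'cV[rat]_r * 'cV[QZ]_s})
    (Phi_bij : bijective Phi) (Phi_A : maps_onto_Zr Phi)
    (dA n m : nat)
    (dA_div : divisibility_parameter A dA)
    (n_gt0 : (0 < n)%N)
    (n_alg : forall ell, prime ell -> forall M : 'M[zpi ell]_s,
       closed_alg_gen (torsion_matrices_at Phi ell)
         ((ell ^ logn ell n)%:R *: M))
    (m_gt0 : (0 < m)%N)
    (m_H1 : exists2 e, exponent_H1 G e & (e %| m)%N) :
  open (kummer_matrices Phi) /\
  exists2 k, Ent A #= `I_k & (k %| (dA * n * m) ^ (r * s))%N.
Proof.
have char0 k : (0 < k)%N -> k%:R != 0 :> L.
  move=> k0; rewrite -(rmorph_nat iota) fmorph_eq0 -(rmorph_nat (in_alg K)).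
  by rewrite fmorph_eq0 pnatr_eq0 -lt0n.
have [xi [psi [xiE xi_ker psiK psiK']]] := coordinates_exist Phi_bij Phi_A.
have psi_bij : bijective psi by exists (fun t => (Phi (gam_of_tors A t)).2).
have xi_surj x : exists y, x = xi y.
  by have [b ->] := gam_class_surj x; exists (Phi b).1.
have V0 := @kummer_image0 _ _ _ L_algebraic _ _ A_rational.
have VD := @kummer_imageD _ _ _ L_algebraic _ _ A_rational.
have V_closed := @kummer_image_closed _ _ _ L_algebraic _ _ A_rational.
have dA0 : (0 < dA)%N by case: dA_div.
have D_gt0 : (0 < dA * m)%N by rewrite muln_gt0 dA0.
have V_ann x : (forall v, @kummer_image _ _ _ _ A v -> v x = 0) -> x *+ (dA * m) = 0.
  have [b ->] := gam_class_surj x => vb.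
  have [e [_ eH1 _] /dvdnP[k ->]] := m_H1.
  (* [m] is the multiple k e of the exponent, and dA e already kills the class. *)
  rewrite mulnCA mulnC mulrnA.
  rewrite (fixed_class_exponent L_algebraic char0 A_rational dA_div eH1) ?mul0rn //.
  move=> sigma galS.
  have [h Vh hE] := kummer_hom_of_gal L_algebraic A_rational galS.
  by apply/eqP; rewrite -subr_eq0 -hE vb.
have H_acts ell e : prime ell -> forall M, torsion_matrices_at Phi ell M ->
    exists2 beta, stabilizes (@kummer_image _ _ _ _ A) beta &
      acts_as psi (ell ^ e)%N M beta.
  move=> ell_pr _ [M0 [_ [sigma galS sE]] <-]; exists (tors_act sigma).
    have tB := tors_actB L_algebraic galS; split=> // v Vv.
    have wB : zmod_morphism (@tors_act _ _ _ G sigma \o v).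
      by move=> x y; rewrite /= raddfB tB.
    pose w : kummer_hom A := HB.pack (@tors_act _ _ _ G sigma \o v)
      (GRing.isZmodMorphism.Build _ _ (@tors_act _ _ _ G sigma \o v) wB).
    by exists w => //; apply: (kummer_image_stable L_algebraic A_rational galS Vv).
  have q0 : (0 < ell ^ e)%N by rewrite expn_gt0 prime_gt0.
  have ellq : (ell : nat_pred).-nat (ell ^ e)%N by rewrite pnatX pnat_id.
  (* On ell^e-torsion a profinite matrix acts through its residues modulo ell^e, which are also
     those of its ell-adic projection. *)
  move=> u uq; rewrite -[LHS]psiK sE psiK'; congr (psi _); apply/colP => i.
  rewrite (zhat_mxactE _ _ q0) // qz_resmx; apply: eq_bigr => j _.
  by rewrite mxE /= /trunc ellq residue_modn.
have V_stable := delta_stab V0 VD H_acts n_alg.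
have V_kills : forall h : kummer_hom A,
    (forall x, x *+ (dA * m * n) = 0 -> h x = 0) -> kummer_image h.
  apply: (hom_kills_mem xi_surj xi_ker psi_bij V0 VD V_closed n_gt0 D_gt0 _ V_ann).
  move=> q i j q0; have [beta [_ bV] bE] := V_stable q i j q0.
  by exists beta.
have N_gt0 : (0 < dA * m * n)%N by rewrite muln_gt0 D_gt0.
split; last first.
  rewrite mulnAC; move: V_kills N_gt0; case: (dA * m * n)%N => // N' V_kills _.
  exact: (card_cosets_kills xi_surj xi_ker psi_bij V0 VD V_kills).
(* The matrices congruent to [M] modulo dA m n form a neighbourhood of [M]; each is shown to be the
   matrix of some [h'] in the Kummer image. *)
rewrite openE => M [h Vh Mh].
apply: filterS (residue_mx_nbhs M (dA * m * n)) => M' /= MM'.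
have [||h' h'E] := @hom_exists _ _ _ _ xi_surj xi_ker
  (fun y => psi (zhat_mxact M' (map_mx qz y))).
- by move=> y z; rewrite map_mxB zhat_mxactB raddfB.
- move=> y /qz_mx_eq0 ->; have -> : zhat_mxact M' 0 = 0; last by rewrite raddf0.
  by have := zhat_mxactB M' 0 0; rewrite !subrr.
exists h'; last by move=> b; rewrite xiE h'E psiK'.
have hE y : h (xi y) = psi (zhat_mxact M (map_mx qz y)).
  have [Psi _ PsiK] := Phi_bij.
  have := Mh (Psi (y, 0)); rewrite xiE PsiK => <- /=.
  by rewrite psiK.
(* [h' - h] kills the classes of order dividing dA m n, on which [M] and [M'] act alike. *)
apply: (VD h (h' \- h : kummer_hom A)) => //; first by move=> x /=; rewrite addrC subrK.
apply: V_kills => x; have [y ->] := xi_surj x => /(xiMn0 xi_ker) yN /=.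
rewrite h'E hE -raddfB.
suff -> : zhat_mxact M' (map_mx qz y) = zhat_mxact M (map_mx qz y).
  by rewrite subrr raddf0.
apply/colP => i; rewrite !(zhat_mxactE _ _ N_gt0) //.
by apply: eq_bigr => j _; rewrite MM'.
Qed.
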